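(* Define $\bar n(j):=e^{j(\log j)^2}$ for $j\ge1$ (so $\bar n(1)=1$, and set $\bar n(0):=0$), and for $n\in(\bar n(j-1),\bar n(j)]$ put $d'_n:=\bar n(j)\,\log\log\bar n(j)/\log 2$. Then \[ \limsup_{n\to\infty}\frac{1}{d'_n}\sum_{k=1}^n\mathsf a'_k=1\quad\text{Lebesgue-almost everywhere.} \]
   Context: $I=(0,1]$, $\mathsf a_n(x)$ denotes the $n$-th continued fraction digit of $x\in I$. $\mathbb P$ is the set of primes. The prime digits are $\mathsf a'_n(x):=\mathsf a_n(x)$ if $\mathsf a_n(x)\in\mathbb P$ and $\mathsf a'_n(x):=0$ otherwise. (Only large $n$ matter, so $d'_n$ for small $n$ where $\log\log$ is undefined may be chosen arbitrarily positive.) *)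

(* Defs.v *)
From HB Require Import structures.
From mathcomp Require Import all_boot all_order all_algebra.
From mathcomp Require Import all_classical all_reals all_analysis.
Set Implicit Arguments. Unset Strict Implicit. Unset Printing Implicit Defensive.
Import Order.TTheory GRing.Theory Num.Theory.
Local Open Scope ring_scope.

Section CF.
Variable R : realType.

(* Gauss map on I = (0,1]; T 0 = 0 (terminated expansion). *)
Definition gauss (x : R) : R :=
  if x == 0 then 0 else x^-1 - (Num.truncn (x^-1))%:R.

(* n-th continued fraction digit a_n(x), n >= 1 :  a_n(x) = floor(1 / T^{n-1} x).
   Convention: once the expansion has terminated (T^{n-1} x = 0), a_n(x) = 0. *)
Definition cf_digit (n : nat) (x : R) : nat :=
  let y := iter n.-1 gauss x in
  if y == 0 then 0%N else Num.truncn (y^-1).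

Definition prime_digit (n : nat) (x : R) : nat :=
  if prime (cf_digit n x) then cf_digit n x else 0%N.

Definition nbar (j : nat) : R :=
  if j == 0%N then 0 else expR (j%:R * (ln j%:R) ^+ 2).

(* j(n) = the least j with n <= nbar j; for n >= 1 it is the unique j >= 1
   with nbar(j-1) < n <= nbar(j) (such j is <= n since nbar j >= j). *)
Definition jidx (n : nat) : nat := find (fun j => n%:R <= nbar j) (iota 0 n.+1).

Definition dprime (n : nat) : R :=
  nbar (jidx n) * ln (ln (nbar (jidx n))) / ln 2.

End CF.

(* Main.v *)
Require Import Defs.
From HB Require Import structures.
From mathcomp Require Import all_boot all_order all_algebra.
From mathcomp Require Import all_classical all_reals all_analysis.
From mathcomp Require Import ring lra zify.
Import Order.TTheory GRing.Theory Num.Theory numFieldNormedType.Exports.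
Set Implicit Arguments. Unset Strict Implicit. Unset Printing Implicit Defensive.

                                                                                  
                                                                 
                                                                                     
                                                                                  
                                         
                                                                                  
                                                                                    
                                                                                   
                                                                                
                                                              
                                                                                
                                                           
                                                                                   
                                                                  
                                                                                  
                                                                                    
                                  
                                                                                 
                                                                                     
                      
                                                                                 
                                                                                  

                                        

(** Under Lebesgue measure the law of the next digit given the past depends only on s = q_{n-1}/q_n,
    the ratio of consecutive convergent denominators: digit a has conditional probability
    (1+s)/((a+s)(a+1+s)), and then s becomes 1/(a+s). A prime digit p contributes about (1+s)/p to
    the conditional mean, so by Mertens's second theorem ([mertens2]) prime digits capped at K have
    conditional mean (1+s) ln ln K + O(1). The stationary mean of 1+s is 1/ln 2, which predicts the
    value n ln ln K / ln 2 for the sum of n capped prime digits.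

    Take n to be the integer part of [nbar j] and K that of d'. Three bad events have measure O(1/ln
    [nbar j]) = O(1/(j (ln j)^2)), which is summable: some prime digit exceeds K ([large_prime_ae]),
    the capped sum strays from the sum of its conditional means ([trunc_prime_ae], a second moment
    bound using the Chebyshev estimate for the number of primes), or the sum of 1+s strays from n/ln
    2 ([potential_ae]). By Borel-Cantelli the ratio in the theorem tends to 1 along the ends of the
    blocks ([prime_word_sum_ae]). Inside a block d' is constant while the digit sums are
    nondecreasing, so the ratio never exceeds its value at the end of the block, and the limsup is 1
    ([limn_esup_ratio]).

    The law of large numbers for 1+s comes from an approximate solution of the Poisson equation
    ([potential]). The transition operator contracts Lipschitz constants by 7/8 ([transfer_lip]) and
    preserves the integral against ds/(1+s) ([gauss_primitive_transfer]), so its iterates on 1+s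
    converge uniformly to 1/ln 2 ([iter_transfer_near]). Martingale theory is replaced by a backward
    recursion over cylinders ([descend_measure_le]). *)

(** * Chebyshev's bound on the product of the primes up to n *)

Lemma prime_ndvd_fact p n : prime p -> n < p -> ~~ (p %| n`!).
Proof.
move=> pp; elim: n => [|n IH] np.
  by rewrite fact0 dvdn1; apply: contraTneq pp => ->.
rewrite factS Euclid_dvdM // negb_or IH ?(ltnW np) // andbT.
by rewrite gtnNdvd.
Qed.

(** Such a prime divides (2m+1)! but neither m! nor (m+1)!, so it survives in the quotient. *)
Lemma prime_dvd_central p m : prime p -> m.+1 < p <= m.*2.+1 -> p %| 'C(m.*2.+1, m).
Proof.
move=> pp /andP[mp pm]; have mm : m <= m.*2.+1 by lia.
have := dvdn_fact (m := p) (n := m.*2.+1); rewrite pm prime_gt0 // => /(_ isT).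
rewrite -(bin_fact mm) !Euclid_dvdM // (_ : m.*2.+1 - m = m.+1); last by lia.
by rewrite (negbTE (prime_ndvd_fact pp mp)) (negbTE (prime_ndvd_fact pp (ltnW mp))) !orbF.
Qed.

(** The coefficient occurs twice in row 2m+1 of Pascal's triangle, whose sum is 2 * 4^m. *)
Lemma central_bin_le m : 'C(m.*2.+1, m) <= 4 ^ m.
Proof.
have e : \sum_(i < m.*2.+2) 'C(m.*2.+1, i) = 2 ^ m.*2.+1.
  by rewrite -[2]/(1 + 1) expnDn; apply: eq_bigr => i _; rewrite !exp1n !muln1.
have h : 'C(m.*2.+1, m) + 'C(m.*2.+1, m.+1) <= 2 ^ m.*2.+1.
  rewrite -e.
  have i0 : m < m.*2.+2 by lia.
  have i1 : m.+1 < m.*2.+2 by lia.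
  rewrite (bigD1 (Ordinal i0)) //= leq_add2l (bigD1 (Ordinal i1)) /=; last first.
    by rewrite -val_eqE /=; lia.
  by rewrite leq_addr.
have : 'C(m.*2.+1, m.+1) = 'C(m.*2.+1, m).
  by rewrite -bin_sub; [congr ('C(_, _)); lia|lia].
move: h; rewrite expnS -mul2n expnM (_ : 2 ^ 2 = 4) //; lia.
Qed.

Lemma primes_prod_dvd a b x : (forall p, prime p -> a <= p < b -> p %| x) ->
  \prod_(a <= p < b | prime p) p %| x.
Proof.
elim: b => [|b IH] H; first by rewrite big_geq.
have [ab|ab] := leqP a b; last by rewrite big_geq.
rewrite big_mkcond big_nat_recr //=.
have IH' := IH (fun p pp h => H p pp ltac:(lia)).
case: (boolP (prime b)) => pb; last by rewrite big_mkcond /= muln1 in IH' *.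
rewrite big_mkcond /= in IH'.
rewrite Gauss_dvd ?IH' ?H //; first by rewrite ab ltnSn.
rewrite coprime_sym prime_coprime // -big_mkcond /= Euclid_dvd_prod //.
rewrite big_nat_cond; apply: (big_ind (fun b => ~~ b)) => //.
  by move=> u v; rewrite negb_or => -> ->.
move=> i /andP[/andP[ai ib] pi]; rewrite gtnNdvd // prime_gt0 //.
Qed.

(** Erdős's induction: an even n > 2 brings no new prime; for n = 2m+1 the primes up to m+1 are
    covered by induction, and the remaining ones all divide a binomial coefficient that is at most
    4^m. *)
Lemma primorial_le n : \prod_(0 <= p < n.+1 | prime p) p <= 4 ^ n.
Proof.
elim/ltn_ind: n => n IH.
have [n2|n2] := ltnP n 3.
  by case: n n2 {IH} => [|[|[|]]] //= _; rewrite unlock /=.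
case: (boolP (odd n)) => on; last first.
  case: n on n2 IH => // n on n2 IH.
  rewrite big_mkcond big_nat_recr //= ifF; last first.
    by apply/negP => /even_prime; move: on n2 => /=; lia.
  rewrite muln1 -big_mkcond /= (leq_trans (IH n _)) // leq_exp2l //.
pose m := n./2; have nE : n = m.*2.+1 by rewrite /m; lia.
rewrite nE (@big_cat_nat _ _ _ m.+2) //=; [|lia].
rewrite (_ : 4 ^ m.*2.+1 = 4 ^ m.+1 * 4 ^ m); last by rewrite -expnD; congr (_ ^ _); lia.
apply: leq_mul; first by apply: IH; lia.
apply: leq_trans (central_bin_le m); apply: dvdn_leq.
  by rewrite bin_gt0; lia.
by apply: primes_prod_dvd => p pp h; apply: prime_dvd_central => //; lia.
Qed.

Local Open Scope ring_scope.

(** * Mertens's theorems and Chebyshev-type estimates for primes *)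

Section Mertens.
Variable R : realType.
Implicit Types (n p k : nat).

Definition prime_sum (F : nat -> R) n := \sum_(0 <= p < n.+1 | prime p) F p.

Lemma prime_sumS F n : prime_sum F n.+1 = prime_sum F n + (if prime n.+1 then F n.+1 else 0).
Proof. by rewrite /prime_sum !(big_mkcond prime) big_nat_recr. Qed.

Lemma ln_sub_le (x y : R) : 0 < x -> 0 < y -> ln y - ln x <= (y - x) / x.
Proof.
move=> x0 y0; rewrite -ln_div ?posrE //.
have -> : y / x = 1 + (y - x) / x by field; rewrite gt_eqF.
apply: le_ln1Dx; rewrite (_ : (y - x) / x = y / x - 1); last by field; rewrite gt_eqF.
by have := divr_gt0 y0 x0; lra.
Qed.

Lemma ln_sub_ge (x y : R) : 0 < x -> 0 < y -> (y - x) / y <= ln y - ln x.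
Proof.
move=> x0 y0; have := ln_sub_le y0 x0.
have -> : (x - y) / y = - ((y - x) / y) by field; rewrite gt_eqF.
lra.
Qed.

Lemma ln_nat_ge0 n : 0 <= ln n%:R :> R.
Proof. by case: n => [|n]; [rewrite ln0|rewrite ln_ge0 // ler1n]. Qed.

Lemma ln2_ge : 1 / 2 <= ln 2 :> R.
Proof. by have := @ln_sub_ge 1 2 ltr01 (ltr0Sn _ _); rewrite ln1; lra. Qed.

Lemma ln2_le1 : ln 2 <= 1 :> R.
Proof. by have := @ln_sub_le 1 2 ltr01 (ltr0Sn _ _); rewrite ln1; lra. Qed.

Lemma ln4 : ln 4 = 2 * ln 2 :> R.
Proof. by rewrite (_ : 4 = 2 * 2) ?lnM ?posrE //; lra. Qed.

Lemma primorial_gt0 n : (0 < \prod_(0 <= p < n.+1 | prime p) p)%N.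
Proof. by rewrite prodn_cond_gt0 // => p; exact: prime_gt0. Qed.

Lemma theta_le n : prime_sum (fun p => ln p%:R) n <= n%:R * ln 4.
Proof.
have -> : prime_sum (fun p => ln p%:R) n = ln (\prod_(0 <= p < n.+1 | prime p) p)%:R.
  elim: n => [|n IH]; first by rewrite /prime_sum !(big_mkcond prime) !big_nat1 ln1.
  rewrite prime_sumS IH [in RHS]big_mkcond [in RHS]big_nat_recr //= -big_mkcond /=.
  by case: ifP => pn; rewrite ?addr0 ?muln1 // natrM lnM ?posrE ?ltr0n ?primorial_gt0.
have := primorial_le n; rewrite -(ler_nat R) => h.
apply: (@le_trans _ _ (ln (4 ^ n)%:R)).
  by rewrite ler_ln ?posrE ?ltr0n ?primorial_gt0 ?expn_gt0.
by rewrite natrX lnXn // mulr_natl.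
Qed.

Lemma ln_fact_le n : ln n`!%:R <= n%:R * ln n%:R :> R.
Proof.
elim: n => [|n IH]; first by rewrite fact0 ln1 mul0r.
rewrite factS natrM lnM ?posrE ?ltr0n ?fact_gt0 //.
have : n%:R * ln n%:R <= n%:R * ln n.+1%:R :> R.
  rewrite ler_wpM2l //; case: n {IH} => [|n]; first by rewrite ln0 // ln1.
  by rewrite ler_ln ?posrE ?ltr0n // ler_nat.
by move: IH; set L := ln n.+1%:R; rewrite -[n.+1%:R]natr1; lra.
Qed.

Lemma ln_fact_ge n : n%:R * ln n%:R - n%:R <= ln n`!%:R :> R.
Proof.
elim: n => [|n IH]; first by rewrite fact0 ln1 mul0r subr0.
rewrite factS natrM lnM ?posrE ?ltr0n ?fact_gt0 //.
have : n%:R * (ln n.+1%:R - ln n%:R) <= 1 :> R.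
  case: n {IH} => [|n]; first by rewrite mul0r.
  apply: (@le_trans _ _ (n.+1%:R * ((n.+2%:R - n.+1%:R) / n.+1%:R))).
    by rewrite ler_wpM2l // ln_sub_le.
  by rewrite mulrC divfK ?pnatr_eq0 // -[n.+2%:R]natr1; lra.
by move: IH; set L := ln n.+1%:R; rewrite -[n.+1%:R]natr1 => h1 h2; lra.
Qed.

Lemma ln_fact_legendre n :
  ln n`!%:R = prime_sum (fun p => (logn p n`!)%:R * ln p%:R) n :> R.
Proof.
suff H m : (m <= n)%N -> ln m`!%:R = prime_sum (fun p => (logn p m`!)%:R * ln p%:R) n :> R by
  exact: H.
elim: m => [_|m IH mn].
  by rewrite fact0 ln1 /prime_sum big1 // => p _; rewrite logn1 mul0r.
have e : ln m.+1%:R = prime_sum (fun p => (logn p m.+1)%:R * ln p%:R) n :> R.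
  have := widen_partn predT mn; rewrite partnT // /prime_sum => {1}->.
  under eq_bigl do rewrite inE.
  rewrite [RHS](big_mkcond prime).
  elim: n.+1 => [|k IHk]; first by rewrite !big_geq // ln1.
  rewrite !big_nat_recr //= natrM lnM ?posrE; last 2 first.
  - by rewrite ltr0n prodn_gt0 // => p; exact: pfactor_gt0.
  - by rewrite ltr0n pfactor_gt0.
  rewrite IHk; congr (_ + _); case: ifP => pk.
    by rewrite natrX lnXn ?ltr0n ?prime_gt0 // mulr_natl.
  by rewrite lognE pk expn0 ln1.
rewrite factS natrM lnM ?posrE ?ltr0n ?fact_gt0 // e IH ?(ltnW mn) //.
rewrite /prime_sum -big_split /=; apply: eq_bigr => p pp.
by rewrite lognM ?fact_gt0 // natrD mulrDl.
Qed.

Lemma prime_sum_le F G n : (forall p, prime p -> (p <= n)%N -> F p <= G p) -> prime_sum F n <=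
  prime_sum G n.
Proof.
move=> FG; rewrite /prime_sum big_nat_cond [leRHS]big_nat_cond; apply: ler_sum => p.
by rewrite ltnS => /andP[/andP[_ pn] pp]; exact: FG.
Qed.

Lemma prime_sumD F G n : prime_sum (fun p => F p + G p) n = prime_sum F n + prime_sum G n.
Proof. exact: big_split. Qed.

Lemma prime_sumZ c F n : prime_sum (fun p => c * F p) n = c * prime_sum F n.
Proof. by rewrite /prime_sum -mulr_sumr. Qed.

Let A n := prime_sum (fun p => ln p%:R / p%:R) n.

(** Since n/p is at most v_p(n!) + 1, weighting by ln p and summing gives at most ln n! plus the
    Chebyshev sum of ln p, which is at most n ln 4. *)
Lemma mertens1_upper n : (0 < n)%N -> A n <= ln n%:R + ln 4.
Proof.
move=> n0; have n0' : 0 < n%:R :> R by rewrite ltr0n.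
rewrite -(ler_pM2l n0').
apply: (@le_trans _ _ (ln n`!%:R + n%:R * ln 4)); last by have := ln_fact_le n; lra.
apply: le_trans (lerD (lexx _) (theta_le n)).
rewrite ln_fact_legendre -prime_sumD -prime_sumZ; apply: prime_sum_le => p pp pn.
have -> : (logn p n`!)%:R * ln p%:R + ln p%:R = ln p%:R * ((logn p n`!)%:R + 1) :> R by ring.
rewrite mulrCA ler_wpM2l ?ln_nat_ge0 //.
rewrite ler_pdivrMr ?ltr0n ?prime_gt0 // natr1 -natrM ler_nat.
apply: leq_trans (ltnW (ltn_ceil n (prime_gt0 pp))) _; rewrite leq_mul2r ltnS; apply/orP; right.
by rewrite logn_fact // big_ltn ?expn1 ?leq_addr // ltnS.
Qed.

Lemma logn_fact_le p n : prime p -> (logn p n`!)%:R <= n%:R / (p%:R - 1) :> R.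
Proof.
move=> pp; have p1 : 1 < p%:R :> R by rewrite ltr1n prime_gt1.
have p0 : p%:R - 1 != 0 :> R by rewrite gt_eqF //; lra.
have p0' : p%:R != 0 :> R by rewrite gt_eqF //; lra.
rewrite logn_fact // natr_sum.
apply: (@le_trans _ _ (n%:R / (p%:R - 1) * (1 - p%:R ^- n))); last first.
  by rewrite ler_piMr ?divr_ge0 ?subr_ge0 ?(ltW p1) // gerBl invr_ge0 exprn_ge0.
have : forall m, \sum_(1 <= k < m.+1) (n %/ p ^ k)%:R <= n%:R / (p%:R - 1) * (1 - p%:R ^- m) :>
  R; last by apply.
elim=> [|m IH]; first by rewrite big_geq // expr0 invr1 subrr mulr0.
rewrite big_nat_recr //=.
have : (n %/ p ^ m.+1)%:R <= n%:R / p%:R ^+ m.+1 :> R.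
  rewrite ler_pdivlMr; last by apply: exprn_gt0; lra.
  by rewrite -natrX -natrM ler_nat leq_trunc_div.
move/(lerD IH) => /le_trans; apply; rewrite le_eqVlt; apply/orP; left; apply/eqP.
by rewrite exprS; field; rewrite p0 p0' expf_neq0.
Qed.

(** The right-hand side is shaped so that the induction closes even if every integer contributes. It
    pays for replacing 1/(p-1) by 1/p in [mertens1_lower]. *)
Lemma prime_sum_ln_div_sqr_le n : (0 < n)%N ->
  prime_sum (fun p => ln p%:R / (p%:R * (p%:R - 1))) n <= 2 - (ln n%:R + 2) / n%:R :> R.
Proof.
case: n => // n _; elim: n => [|n IH].
  by rewrite /prime_sum (big_mkcond prime) !big_nat_recr //= big_geq // ln1; lra.
rewrite prime_sumS.
have h : 0 <= ln n.+2%:R / (n.+2%:R * (n.+2%:R - 1)) :> R.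
  by rewrite divr_ge0 ?ln_nat_ge0 // mulr_ge0 // subr_ge0 ler1n.
apply: (@le_trans _ _ (prime_sum (fun p => ln p%:R / (p%:R * (p%:R - 1))) n.+1 + ln n.+2%:R /
  (n.+2%:R * (n.+2%:R - 1)))).
  by rewrite lerD2l; case: ifP.
apply: le_trans (lerD IH (lexx _)) _.
have := @ln_sub_le n.+1%:R n.+2%:R (ltr0Sn _ _) (ltr0Sn _ _).
move: (ln n.+1%:R) (ln n.+2%:R) => a b.
have : 1 <= n.+1%:R :> R by rewrite ler1n.
rewrite -[n.+2%:R]natr1; move: (n.+1%:R) => x x1.
have x0 : 0 < x by lra.
rewrite (_ : (x + 1 - x) / x = x^-1); last by field; rewrite gt_eqF.
move=> h1.
rewrite -subr_ge0 (_ : _ - _ = (2 - (x + 1) * (b - a)) / (x * (x + 1))); last first.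
  by field; rewrite !gt_eqF //; lra.
rewrite divr_ge0 ?mulr_ge0 //; try lra.
have : (x + 1) * (b - a) <= (x + 1) / x by rewrite ler_wpM2l //; lra.
have : (x + 1) / x <= 2 by rewrite ler_pdivrMr //; lra.
lra.
Qed.

(** Legendre's formula with the geometric bound v_p(n!) <= n/(p-1), against the elementary Stirling
    bound. Of the constant 3, Stirling costs 1 and the passage from 1/(p-1) to 1/p costs 2. *)
Lemma mertens1_lower n : (0 < n)%N -> ln n%:R - 3 <= A n.
Proof.
move=> n0; have n0' : 0 < n%:R :> R by rewrite ltr0n.
have h1 : n%:R * ln n%:R - n%:R <= n%:R * prime_sum (fun p => ln p%:R / (p%:R - 1)) n :> R.
  rewrite -prime_sumZ (le_trans (ln_fact_ge n)) // ln_fact_legendre.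
  apply: prime_sum_le => p pp pn.
  by rewrite mulrCA mulrC ler_wpM2l ?ln_nat_ge0 // logn_fact_le.
have h2 : ln n%:R - 1 <= prime_sum (fun p => ln p%:R / (p%:R - 1)) n :> R.
  by rewrite -(ler_pM2l n0'); lra.
have h3 : prime_sum (fun p => ln p%:R / (p%:R - 1)) n <=
  A n + prime_sum (fun p => ln p%:R / (p%:R * (p%:R - 1))) n.
  rewrite -prime_sumD; apply: prime_sum_le => p pp _.
  have p1 : 1 < p%:R :> R by rewrite ltr1n prime_gt1.
  rewrite le_eqVlt; apply/orP; left; apply/eqP; field.
  by rewrite !gt_eqF //; lra.
have h4 := prime_sum_ln_div_sqr_le n0.
have h5 : 0 <= (ln n%:R + 2) / n%:R :> R by rewrite divr_ge0 // addr_ge0 // ln_nat_ge0.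
lra.
Qed.

Lemma mertens1 n : (0 < n)%N -> `|A n - ln n%:R| <= 3.
Proof.
move=> n0; have := mertens1_lower n0; have := mertens1_upper n0.
have := ln2_le1; rewrite ln4 ler_norml; lra.
Qed.

Lemma ln_nat_gt0 n : 0 < ln n.+2%:R :> R.
Proof. by rewrite ln_gt0 // ltr1n. Qed.

Let S n := prime_sum (fun p => p%:R^-1) n : R.
Let B n := S n - A n / ln n%:R.

                                                                       
(** Abel summation: at a new prime p the increments 1/p and (ln p / p)/ln p cancel, so only the
    change of the weight 1/ln n remains. *)
Let BS n : B n.+3 - B n.+2 = A n.+2 * ((ln n.+2%:R)^-1 - (ln n.+3%:R)^-1).
Proof.
rewrite /B /S /A !prime_sumS.
set a := prime_sum _ n; set b := prime_sum _ n.
have := ln_nat_gt0 n; have := ln_nat_gt0 n.+1.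
have := ltr0Sn R n.+2.
move: (@ln R n.+3%:R) (@ln R n.+2%:R) (n.+3%:R : R) => x y z z0 x0 y0.
by case: ifP => _; case: ifP => _; case: ifP => _; field; rewrite ?gt_eqF.
Qed.

Lemma mertens2 : exists C : R, forall n, (2 <= n)%N ->
  `|prime_sum (fun p => p%:R^-1) n - ln (ln n%:R)| <= C.
Proof.
have H n : (ln n.+2%:R <= ln n.+3%:R :> R) && (ln n.+3%:R <= ln n.+2%:R + 1 :> R).
  have := @ln_sub_le n.+2%:R n.+3%:R (ltr0Sn _ _) (ltr0Sn _ _).
  rewrite ler_ln ?posrE ?ltr0n // ler_nat leqnSn /=.
  have : (n.+3%:R - n.+2%:R) / n.+2%:R <= 1 :> R.
    rewrite ler_pdivrMr ?ltr0n // mul1r lerBlDr -natrD ler_nat; lia.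
  by move: (_ / _) => d h1 h2; rewrite -lerBlDl (le_trans h2).
(* Write l, l' for consecutive logarithms and d = 1/l - 1/l'. By [mertens1] the increment of [B]
   lies between (l-3)d and (l+3)d, and that of ln ln between l d and (l+1)d. The corrections 3/l and
   4/l absorb the difference, so [U] decreases and [V] increases. *)
pose U n := B n.+2 - ln (ln n.+2%:R) + 3 / ln n.+2%:R.
pose V n := B n.+2 - ln (ln n.+2%:R) - 4 / ln n.+2%:R.
have stepU n : U n.+1 <= U n /\ V n <= V n.+1.
  rewrite /U /V; have := BS n; have /andP[] := H n; have := ln_nat_gt0 n;
    have := ln_nat_gt0 n.+1.
  have := @mertens1 n.+2 isT; rewrite ler_norml => /andP[].
  move: (A n.+2) (B n.+3) (B n.+2) (@ln R n.+3%:R) (@ln R n.+2%:R) => a b' b l' l a1 a2 l0' l0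
    ll' l1.
  have := ln_sub_le l0 l0'; have := ln_sub_ge l0 l0'.
  move: (ln l) (ln l') => m m' h1 h2 e.
  have d0 : 0 <= l^-1 - l'^-1 by rewrite subr_ge0 lef_pV2.
  have e1 : (l' - l) / l' = l * (l^-1 - l'^-1) by field; rewrite !gt_eqF.
  have e2 : (l' - l) / l = l * (l^-1 - l'^-1) + (l' - l) * (l^-1 - l'^-1) by field;
    rewrite !gt_eqF.
  have h3 : (l' - l) * (l^-1 - l'^-1) <= l^-1 - l'^-1.
    by rewrite ler_piMl //; lra.
  have h4 : (l - 3) * (l^-1 - l'^-1) <= a * (l^-1 - l'^-1) by rewrite ler_wpM2r //; lra.
  have h5 : a * (l^-1 - l'^-1) <= (l + 3) * (l^-1 - l'^-1) by rewrite ler_wpM2r //; lra.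
  by split; lra.
have Ub n : U n <= U 0%N by elim: n => // n /(le_trans (stepU n).1).
have Vb n : V 0%N <= V n by elim: n => // n IH; exact: (le_trans IH (stepU n).2).
have bd n : 0 <= (@ln R n.+2%:R)^-1 <= 2.
  rewrite invr_ge0 (ltW (ln_nat_gt0 _)) /= -[2%:R]invrK lef_pV2 ?posrE ?invr_gt0 ?ln_nat_gt0 //.
  apply: (@le_trans _ _ (ln 2)); first by have := ln2_ge; lra.
  by rewrite ler_ln ?posrE ?ltr0n // ler_nat.
exists (`|U 0%N| + `|V 0%N| + 20) => -[|[|n]] // _.
have := bd n; have := Ub n; have := Vb n; have := ler_norm (U 0%N); have := ler_norm (- V 0%N).
rewrite normrN => h1 h2; rewrite {2}/V {1}/U /B -/(S n.+2).
move: h1 h2.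
have := @mertens1 n.+2 isT; rewrite ler_norml => /andP[].
have := ln_nat_gt0 n; have := normr_ge0 (U 0%N); have := normr_ge0 (V 0%N).
move: `|U 0%N| `|V 0%N| (U 0%N) (V 0%N) => nu nv u v.
move: (A n.+2) (S n.+2) (@ln R (ln n.+2%:R)) (@ln R n.+2%:R) => a s m l nu0 nv0 l0 a1 a2 k1 k2
  k3 k4 /andP[i0 i2].
have h1 : a / l <= 1 + 3 / l.
  by rewrite ler_pdivrMr // mulrDl mul1r divfK ?gt_eqF //; lra.
have h2 : 1 - 3 / l <= a / l.
  by rewrite ler_pdivlMr // mulrBl mul1r divfK ?gt_eqF //; lra.
rewrite ler_norml; lra.
Qed.

(** While (n+1)^2 <= N the count is at most n+1; afterwards it no longer grows. This avoids an
    integer square root. *)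
Lemma prime_sum_small_sqr (N n : nat) :
  prime_sum (fun p => (p * p <= N)%:R) n ^+ 2 <= N%:R :> R.
Proof.
have c m : prime_sum (fun p => (p * p <= N)%:R) m <= m%:R :> R.
  elim: m => [|m IH]; first by rewrite /prime_sum (big_mkcond prime) big_nat1.
  rewrite prime_sumS -[m.+1%:R]natr1 lerD //; by case: ifP => _; rewrite ?ler01 // lern1 leq_b1.
elim: n => [|n IH]; first by rewrite /prime_sum (big_mkcond prime) big_nat1 /= expr0n.
have c0 : 0 <= prime_sum (fun p => (p * p <= N)%:R) n.+1 :> R by apply: sumr_ge0.
case: (leqP (n.+1 * n.+1) N) => [h|h]; last first.
  by rewrite prime_sumS leqNgt h /= if_same addr0.
by rewrite (le_trans (lerXn2r 2 _ _ (c n.+1))) ?nnegrE // -natrX ler_nat.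
Qed.

(** There are at most sqrt n primes with p^2 <= n, and ln n <= 2 sqrt n; for every other prime ln n
    <= 2 ln p, which the Chebyshev sum pays for. *)
Lemma prime_count_le n : prime_sum (fun=> 1) n * ln n%:R <= 6 * n%:R :> R.
Proof.
have [->|n0] := posnP n; first by rewrite ln0 // !mulr0.
have n0' : 0 < n%:R :> R by rewrite ltr0n.
set c := prime_sum (fun p => (p * p <= n)%:R) n : R.
have h1 : prime_sum (fun=> 1) n * ln n%:R <= ln n%:R * c + 2 * prime_sum (fun p => ln p%:R) n
  :> R.
  rewrite mulrC -!prime_sumZ -prime_sumD; apply: prime_sum_le => p pp _.
  have := ln_nat_ge0 p; case: leqP => [_|h] /=; first by lra.
  rewrite mulr0 mulr1 add0r => _.
  have p0 : 0 < p%:R :> R by rewrite ltr0n prime_gt0.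
  rewrite (_ : 2 * ln _ = ln (p%:R * p%:R)); last by rewrite lnM ?posrE //; lra.
  by rewrite ler_ln ?posrE ?mulr_gt0 // -natrM ler_nat ltnW.
have c0 : 0 <= c by apply: sumr_ge0.
have c2 : c ^+ 2 <= n%:R by exact: prime_sum_small_sqr.
have s0 : 0 < Num.sqrt n%:R :> R by rewrite sqrtr_gt0.
have s2 : Num.sqrt n%:R ^+ 2 = n%:R :> R by rewrite sqr_sqrtr // ltW.
have cs : c <= Num.sqrt n%:R by rewrite -(ger0_norm c0) -sqrtr_sqr ler_wsqrtr.
have l2 : ln n%:R <= 2 * Num.sqrt n%:R :> R.
  by rewrite -{1}s2 lnXn // mulr2n; have := ln_sublinear s0; lra.
have h2 : ln n%:R * c <= 2 * n%:R.
  have -> : 2 * n%:R = 2 * Num.sqrt n%:R * Num.sqrt n%:R :> R by rewrite -mulrA -expr2 s2.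
  by rewrite ler_pM // ln_nat_ge0.
have := theta_le n; have := ln2_le1; rewrite ln4.
have : n%:R * ln 2 <= n%:R :> R by rewrite ler_piMr ?ln2_le1 // ltW.
lra.
Qed.

(** Partial summation of ln p against 1/p^2 gives 4/d; then ln d is divided out because ln p >= ln d
    on the tail. *)
Lemma prime_tail_le d N : (2 <= d)%N -> (d <= N)%N ->
  prime_sum (fun p => if (d < p)%N then p%:R ^- 2 else 0) N <= 4 / (d%:R * ln d%:R) :> R.
Proof.
move=> d2 dN; have d0 : 0 < d%:R :> R by rewrite ltr0n; lia.
have ld0 : 0 < ln d%:R :> R by rewrite ln_gt0 // ltr1n.
pose th n := prime_sum (fun p => ln p%:R) n : R.
pose G n := prime_sum (fun p => if (d < p)%N then ln p%:R / p%:R ^+ 2 else 0) n : R.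
(* The term [th N / N^2] is the boundary term of the partial summation; carrying it along makes the
   induction on [N] close. *)
suff h : G N <= th N / N%:R ^+ 2 + 2 * ln 4 * (d%:R^-1 - N%:R^-1).
  have N0 : 0 < N%:R :> R by rewrite ltr0n; lia.
  have h1 : th N / N%:R ^+ 2 <= ln 4 / N%:R.
    rewrite ler_pdivrMr ?exprn_gt0 // expr2 mulrA divfK ?gt_eqF // mulrC; exact: theta_le.
  have h2 : G N <= 4 / d%:R.
    have : ln 4 / d%:R <= 2 / d%:R :> R by rewrite ler_pM2r ?invr_gt0 // ln4; have := ln2_le1;
      lra.
    have : 0 <= ln 4 / N%:R :> R by rewrite divr_ge0 ?ltW // ln_gt0 // ltr1n.
    lra.
  rewrite invfM mulrA ler_pdivlMr // mulrC -prime_sumZ (le_trans _ h2) //.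
  apply: prime_sum_le => p pp _; case: ifP => dp; last by rewrite mulr0.
  have p0 : 0 < p%:R :> R by rewrite ltr0n prime_gt0.
  by rewrite ler_pM2r ?invr_gt0 ?exprn_gt0 // ler_ln ?posrE // ler_nat ltnW.
elim: N dN => [|N IH dN]; first by lia.
have [dN'|dN'] := leqP d N; last first.
  have -> : d = N.+1 by lia.
  rewrite subrr mulr0 addr0 /G /prime_sum big_nat_cond big1 ?divr_ge0 //.
    by apply: sumr_ge0 => p _; exact: ln_nat_ge0.
  by move=> p /andP[/andP[_ h] _]; rewrite ifF //; lia.
have N0 : 0 < N%:R :> R by rewrite ltr0n; lia.
have := theta_le N; rewrite -/(th N) => t1.
have t0 : 0 <= th N by apply: sumr_ge0 => p _; exact: ln_nat_ge0.
rewrite /G /th !prime_sumS -/(th N) -/(G N) ltnS dN'.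
have := IH dN'; have : 0 < N.+1%:R :> R by rewrite ltr0n.
move: (@ln R N.+1%:R) => a; rewrite -[N.+1%:R]natr1.
move: t1 t0 N0; move: (th N) (G N) (N%:R : R) (ln 4) => t g x l t1 t0 x0 x1 IHN.
have key : t * (x ^- 2 - (x + 1) ^- 2) <= 2 * l * (x^-1 - (x+1)^-1).
  have e : x ^- 2 - (x + 1) ^- 2 = (2 * x + 1) / (x ^+ 2 * (x + 1) ^+ 2).
    by field; rewrite !gt_eqF.
  apply: (@le_trans _ _ (x * l * (x ^- 2 - (x + 1) ^- 2))).
    by rewrite ler_wpM2r // e divr_ge0 ?mulr_ge0 ?exprn_ge0 //; lra.
  have l0 : 0 <= l by have := le_trans t0 t1; rewrite pmulr_rge0.
  rewrite -subr_ge0 (_ : _ - _ = l / (x * (x + 1) ^+ 2)); last by field; rewrite !gt_eqF.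
  by rewrite divr_ge0 // mulr_ge0 ?exprn_ge0 // ltW.
case: ifP => _; rewrite ?mulrDl; lra.
Qed.

End Mertens.

Local Open Scope classical_set_scope.

                                  

(** * Conditional law of the next digit *)

Section Transition.
Variable R : realType.
Implicit Types (s t : R) (k n N : nat) (F G : nat -> R).

(** With s = q_{n-1}/q_n this is the conditional Lebesgue probability that the next digit is k+1;
    the shift by one lets k range over all of [nat]. Likewise [digit_tail s k] is the probability
    that the digit exceeds k. *)
Definition digit_weight s k : R := (1 + s) / ((k.+1%:R + s) * (k.+2%:R + s)).
Definition digit_tail s k : R := (1 + s) / (k.+1%:R + s).

Lemma natS_gt0 k s : 0 <= s -> 0 < k.+1%:R + s.
Proof. by move=> s0; rewrite ltr_pwDl ?ltr0n. Qed.

Lemma digit_weightE s k : 0 <= s -> digit_weight s k = digit_tail s k - digit_tail s k.+1.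
Proof.
move=> s0; rewrite /digit_weight /digit_tail.
have := natS_gt0 k s0; have := natS_gt0 k.+1 s0.
rewrite -[k.+2%:R]natr1; move: (k.+1%:R : R) => x h1 h2; field.
by rewrite !gt_eqF //; lra.
Qed.

Lemma digit_weight_ge0 s k : 0 <= s -> 0 <= digit_weight s k.
Proof. by move=> s0; rewrite divr_ge0 ?addr_ge0 // ltW // mulr_gt0 // natS_gt0. Qed.

Lemma digit_tail_ge0 s k : 0 <= s -> 0 <= digit_tail s k.
Proof. by move=> s0; rewrite divr_ge0 ?addr_ge0 // ltW // natS_gt0. Qed.

Lemma sum_digit_weight s N : 0 <= s -> \sum_(0 <= k < N) digit_weight s k = 1 - digit_tail s N.
Proof.
move=> s0; elim: N => [|N IH].
  by rewrite big_geq // /digit_tail divff ?subrr // gt_eqF // ltr_pwDl.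
by rewrite big_nat_recr //= IH digit_weightE //; lra.
Qed.

Lemma digit_tail_le s N : 0 <= s <= 1 -> digit_tail s N <= 2 / N.+1%:R.
Proof.
move=> /andP[s0 s1]; rewrite /digit_tail.
rewrite ler_pdivrMr ?natS_gt0 // mulrAC ler_pdivlMr ?ltr0n //.
have : 1 <= N.+1%:R :> R by rewrite ler1n.
move: (N.+1%:R : R) => x x1; nra.
Qed.

Definition bounded_seq F := exists M : R, forall k, `|F k| <= M.

Lemma bounded_seqD F G : bounded_seq F -> bounded_seq G -> bounded_seq (fun k => F k + G k).
Proof.
move=> [M HM] [M' HM']; exists (M + M') => k.
by rewrite (le_trans (ler_normD _ _)) // lerD.
Qed.

Lemma bounded_seqM F G : bounded_seq F -> bounded_seq G -> bounded_seq (fun k => F k * G k).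
Proof. by move=> [M HM] [M' HM']; exists (M * M') => k; rewrite normrM ler_pM. Qed.

Lemma bounded_seq_cst c : bounded_seq (fun=> c).
Proof. by exists `|c|. Qed.

Lemma bounded_seqB F G : bounded_seq F -> bounded_seq G -> bounded_seq (fun k => F k - G k).
Proof.
move=> [M HM] [M' HM']; exists (M + M') => k.
by rewrite (le_trans (ler_normB _ _)) // lerD.
Qed.

Definition digit_psum s F N := \sum_(0 <= k < N) digit_weight s k * F k.
Definition digit_mean s F := limn (digit_psum s F).

Lemma digit_mean_cvg s F : 0 <= s -> bounded_seq F -> digit_psum s F @ \oo --> digit_mean s F.
Proof.
move=> s0 [M HM].
have M0 : 0 <= M by apply: le_trans (HM 0%N).
have h : cvgn [normed series (fun k => digit_weight s k * F k)].
  apply: nondecreasing_is_cvgn.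
    apply/nondecreasing_seqP => n; rewrite /= /series /= big_nat_recr //= lerDl //.
  exists M => _ [n _ <-]; rewrite /= /series /=.
  apply: (@le_trans _ _ (\sum_(0 <= k < n) digit_weight s k * M)).
    apply: ler_sum => k _; rewrite normrM ger0_norm ?digit_weight_ge0 //.
    by rewrite ler_wpM2l ?digit_weight_ge0.
  rewrite -mulr_suml sum_digit_weight // ler_piMl // gerBl digit_tail_ge0 //.
exact: (normed_cvg h).
Qed.

Lemma digit_meanE s F l : 0 <= s -> digit_psum s F @ \oo --> l -> digit_mean s F = l.
Proof. by move=> s0 h; apply/cvg_lim. Qed.

Lemma digit_meanD s F G : 0 <= s -> bounded_seq F -> bounded_seq G ->
  digit_mean s (fun k => F k + G k) = digit_mean s F + digit_mean s G.
Proof.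
move=> s0 hF hG; apply: digit_meanE => //.
rewrite (_ : digit_psum _ _ = digit_psum s F \+ digit_psum s G).
  by apply: cvgD; exact: digit_mean_cvg.
by apply/funext => N; rewrite /digit_psum /= -big_split /=; apply: eq_bigr => k _;
  rewrite mulrDr.
Qed.

Lemma digit_meanZ s c F : 0 <= s -> bounded_seq F ->
  digit_mean s (fun k => c * F k) = c * digit_mean s F.
Proof.
move=> s0 hF; apply: digit_meanE => //.
rewrite (_ : digit_psum _ _ = (fun N => c * digit_psum s F N)).
  by apply: cvgMr; exact: digit_mean_cvg.
by apply/funext => N; rewrite /digit_psum /= mulr_sumr; apply: eq_bigr => k _; rewrite mulrCA.
Qed.

Lemma digit_meanB s F G : 0 <= s -> bounded_seq F -> bounded_seq G ->
  digit_mean s (fun k => F k - G k) = digit_mean s F - digit_mean s G.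
Proof.
move=> s0 hF hG; apply: digit_meanE => //.
rewrite (_ : digit_psum _ _ = digit_psum s F \- digit_psum s G).
  by apply: cvgB; exact: digit_mean_cvg.
by apply/funext => N; rewrite /digit_psum /= -sumrB /=; apply: eq_bigr => k _; rewrite mulrBr.
Qed.

Lemma digit_tail_cvg0 s : 0 <= s <= 1 -> digit_tail s @ \oo --> (0 : R).
Proof.
move=> s01; have /andP[s0 s1] := s01.
apply: (@squeeze_cvgr _ _ _ _ (fun=> 0) (fun N => 2 * N.+1%:R^-1)).
- by near=> N; rewrite digit_tail_ge0 //= digit_tail_le.
- exact: cvg_cst.
- rewrite -[X in _ --> X](mulr0 2); apply: cvgMr; exact: cvg_harmonic.
Unshelve. all: by end_near. Qed.

Lemma digit_mean_cst s c : 0 <= s <= 1 -> digit_mean s (fun=> c) = c.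
Proof.
move=> s01; have /andP[s0 s1] := s01; apply: digit_meanE => //.
rewrite (_ : digit_psum _ _ = (fun N => c - c * digit_tail s N)); last first.
  by apply/funext => N; rewrite /digit_psum -mulr_suml sum_digit_weight //; ring.
rewrite -[X in _ --> X]subr0 -[X in _ --> _ - X](mulr0 c).
apply: cvgB; first exact: cvg_cst.
by apply: cvgMr; exact: digit_tail_cvg0.
Qed.

Lemma digit_mean_le s F G : 0 <= s -> bounded_seq F -> bounded_seq G ->
  (forall k, F k <= G k) -> digit_mean s F <= digit_mean s G.
Proof.
move=> s0 hF hG FG; apply: ler_cvg_to (digit_mean_cvg s0 hF) (digit_mean_cvg s0 hG) _.
by near=> N; apply: ler_sum => k _; rewrite ler_wpM2l ?digit_weight_ge0.
Unshelve. all: by end_near. Qed.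

Lemma digit_psum_le_mean s F N : 0 <= s -> bounded_seq F -> (forall k, 0 <= F k) ->
  digit_psum s F N <= digit_mean s F.
Proof.
move=> s0 hF F0; apply: nondecreasing_cvgn_le; last by apply: cvgP (digit_mean_cvg s0 hF).
apply/nondecreasing_seqP => n; rewrite /digit_psum big_nat_recr //= lerDl.
by rewrite mulr_ge0 ?digit_weight_ge0.
Qed.

Lemma digit_psum_mean_dist s F M N : 0 <= s <= 1 -> (forall k, `|F k| <= M) ->
  `|digit_mean s F - digit_psum s F N| <= M * digit_tail s N.
Proof.
move=> s01 HM; have /andP[s0 s1] := s01; have bF : bounded_seq F by exists M.
have h : (fun n => `|digit_psum s F n - digit_psum s F N|) @ \oo --> `|digit_mean s F -
  digit_psum s F N|.
  apply: cvg_norm; apply: cvgB; [exact: digit_mean_cvg|exact: cvg_cst].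
apply: (ler_cvg_to h (@cvg_cst _ _ _ _ _)); near=> n.
have Nn : (N <= n)%N by near: n; exact: nbhs_infty_ge.
rewrite /digit_psum (@big_cat_nat _ _ _ N 0 n) //= addrAC subrr add0r.
apply: (le_trans (ler_norm_sum _ _ _)).
apply: (@le_trans _ _ (\sum_(N <= k < n) digit_weight s k * M)).
  apply: ler_sum => k _; rewrite normrM ger0_norm ?digit_weight_ge0 //.
  by rewrite ler_wpM2l ?digit_weight_ge0.
rewrite -mulr_suml mulrC ler_wpM2l //; first exact: le_trans (HM 0%N).
have := sum_digit_weight n s0; rewrite (@big_cat_nat _ _ _ N 0 n) //= sum_digit_weight //.
have := digit_tail_ge0 n s0; lra.
Unshelve. all: by end_near. Qed.

Lemma digit_mean_finite s F K : 0 <= s -> (forall k, (K <= k)%N -> F k = 0) ->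
  digit_mean s F = digit_psum s F K.
Proof.
move=> s0 F0; apply: digit_meanE => //; apply: (@cvg_near_cst _ _ _ _ _); near=> n.
have Kn : (K <= n)%N by near: n; exact: nbhs_infty_ge.
rewrite /digit_psum (@big_cat_nat _ _ _ K 0 n) //= [X in _ + X]big_nat_cond [X in _ + X]big1
  ?addr0 //.
by move=> k /andP[/andP[Kk _] _]; rewrite F0 // mulr0.
Unshelve. all: by end_near. Qed.

(** The cross term has mean zero and a variance is at most the second moment: one step of the
    orthogonality of martingale differences. *)
Lemma digit_mean_sqr s F z : 0 <= s <= 1 -> bounded_seq F ->
  digit_mean s (fun k => (z + (F k - digit_mean s F)) ^+ 2)
  <= z ^+ 2 + digit_mean s (fun k => F k ^+ 2).
Proof.
move=> s01 hF; have /andP[s0 s1] := s01; set m := digit_mean s F.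
have b2 : bounded_seq (fun k => F k ^+ 2) by apply: bounded_seqM.
have -> : (fun k => (z + (F k - m)) ^+ 2) = (fun k => F k ^+ 2 + (2 * (z - m) * F k + (z - m)
  ^+ 2)).
  by apply/funext => k; ring.
have bc := bounded_seq_cst; have b1 : bounded_seq (fun k => 2 * (z - m) * F k) by apply:
  bounded_seqM.
rewrite digit_meanD //; last by apply: bounded_seqD.
rewrite digit_meanD // digit_meanZ // digit_mean_cst // -/m addrC lerD2r.
by rewrite -subr_ge0 (_ : _ - _ = m ^+ 2) ?sqr_ge0 //; ring.
Qed.

End Transition.

                                

(** * The transition operator contracts Lipschitz constants *)

Section Contraction.
Variable R : realType.
Implicit Types (s t : R) (k n N : nat) (f Phi : R -> R).

(** The ratio q_n/q_{n+1} obtained from s = q_{n-1}/q_n when the new digit is k+1; [transfer] is the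
    Markov operator of this chain. *)
Definition next_state s k : R := (k.+1%:R + s)^-1.
Definition transfer f s : R := digit_mean s (fun k => f (next_state s k)).
Definition lip01 (L : R) f := forall x y, 0 <= x <= 1 -> 0 <= y <= 1 -> `|f x - f y| <= L * `|x
  - y|.

Lemma next_state01 s k : 0 <= s <= 1 -> 0 <= next_state s k <= 1.
Proof.
move=> /andP[s0 s1]; rewrite invr_ge0 (ltW (natS_gt0 _ _)) //=.
rewrite invf_le1 ?natS_gt0 //; have : 1 <= k.+1%:R :> R by rewrite ler1n.
lra.
Qed.

Lemma next_state_dist s t k : 0 <= s -> 0 <= t ->
  next_state s k - next_state t k = (t - s) / ((k.+1%:R + s) * (k.+1%:R + t)).
Proof.
move=> s0 t0; rewrite /next_state; have := natS_gt0 k s0; have := natS_gt0 k t0.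
by move: (k.+1%:R : R) => x h1 h2; field; rewrite !gt_eqF.
Qed.

Lemma lip01_bounded L f x : 0 <= L -> lip01 L f -> 0 <= x <= 1 -> `|f x| <= `|f 0| + L.
Proof.
move=> L0 fL x01; have : `|f x - f 0| <= L.
  apply: (le_trans (fL _ _ x01 _)); first by rewrite lexx ler01.
  by rewrite subr0 ler_piMr // ger0_norm //; case/andP: x01.
by move=> h; rewrite -[f x](subrK (f 0)) addrC (le_trans (ler_normD _ _)) // lerD2l.
Qed.

Lemma lip01_bounded_seq L f s : 0 <= L -> lip01 L f -> 0 <= s <= 1 ->
  bounded_seq (fun k => f (next_state s k)).
Proof.
move=> L0 fL s01; exists (`|f 0| + L) => k.
by apply: lip01_bounded => //; exact: next_state01.
Qed.

Lemma digit_weight0_le s : 0 <= s -> digit_weight s 0 <= 1 / 2.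
Proof.
move=> s0; rewrite /digit_weight ler_pdivrMr; last by rewrite mulr_gt0 // natS_gt0.
nra.
Qed.

                                                                                  
                        
                                                    
(** Only the next state moves, the weights stay at s. The branches with k >= 1 contract by 1/4, the
    branch k = 0 does not expand and has weight at most 1/2: 1/4 + 3/4 * 1/2 = 5/8. *)
Lemma transfer_lip_diag L f s t : 0 <= L -> lip01 L f -> 0 <= s <= 1 -> 0 <= t <= 1 ->
  `|digit_mean s (fun k => f (next_state s k) - f (next_state t k))| <= 5 / 8 * L * `|s - t|.
Proof.
move=> L0 fL s01 t01; have /andP[s0 s1] := s01; have /andP[t0 t1] := t01.
pose D := fun k => f (next_state s k) - f (next_state t k).
pose E := fun k => L * `|s - t| * (1 / 4 + (if k == 0%N then 3 / 4 else 0)).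
have DE k : `|D k| <= E k.
  apply: (le_trans (fL _ _ (next_state01 k s01) (next_state01 k t01))).
  rewrite /E -mulrA ler_wpM2l // next_state_dist // normrM distrC ler_wpM2l //.
  have p1 := natS_gt0 k s0; have p2 := natS_gt0 k t0.
  rewrite ger0_norm ?invr_ge0 ?mulr_ge0 ?(ltW p1) ?(ltW p2) //.
  rewrite -div1r ler_pdivrMr ?mulr_gt0 //.
  case: k {p1 p2} => [|k] /=; first by nra.
  have : 2 <= k.+2%:R :> R by rewrite ler_nat.
  by move: (k.+2%:R : R) => x x2; nra.
have bE : bounded_seq E.
  exists (L * `|s - t|) => k; rewrite /E ger0_norm.
    by rewrite ler_piMr ?mulr_ge0 //; case: ifP => _; lra.
  by rewrite !mulr_ge0 //; case: ifP => _; lra.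
have bD : bounded_seq D by apply: bounded_seqB; apply: lip01_bounded_seq fL _.
have mE : digit_mean s E <= 5 / 8 * L * `|s - t|.
  have b4 : bounded_seq (fun k => if k == 0%N then 3 / 4 else 0 : R).
    by exists 1 => k; rewrite ger0_norm; case: ifP => _; lra.
  rewrite /E digit_meanZ //; last by apply: bounded_seqD => //; exact: bounded_seq_cst.
  rewrite digit_meanD //; last exact: bounded_seq_cst.
  rewrite digit_mean_cst // (@digit_mean_finite _ _ _ 1) //; last by case.
  rewrite /digit_psum big_nat1 /=.
  have := digit_weight0_le s0; have : 0 <= L * `|s - t| by rewrite mulr_ge0.
  rewrite -[5 / 8 * L * _]mulrA.
  by move: (L * `|s - t|) (digit_weight s 0) => a b a0 b0; nra.
rewrite ler_norml; apply/andP; split; last first.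
  apply: le_trans mE; apply: digit_mean_le => // k.
  by have := DE k; rewrite ler_norml => /andP[].
rewrite lerNl; apply: le_trans mE.
rewrite -mulN1r -digit_meanZ //; apply: digit_mean_le => //.
  by apply: bounded_seqM => //; exact: bounded_seq_cst.
by move=> k; have := DE k; rewrite ler_norml mulN1r lerNl => /andP[].
Qed.

                                        
                                                                          
(** Only the weights move. Summation by parts shifts the difference from weights to tails and onto
    increments of f along the branches; the constant is the sum of 1/(n(n+1)(n+2)) over n >= 1,
    which is 1/4. *)
Lemma transfer_lip_weight L f s t : 0 <= L -> lip01 L f -> 0 <= s <= 1 -> 0 <= t <= 1 ->
  `|digit_mean s (fun k => f (next_state t k)) - digit_mean t (fun k => f (next_state t k))|
    <= 1 / 4 * L * `|s - t|.
Proof.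
move=> L0 fL s01 t01; have /andP[s0 s1] := s01; have /andP[t0 t1] := t01.
pose G := fun k => f (next_state t k).
have bG : bounded_seq G by apply: lip01_bounded_seq fL _.
pose d k := digit_tail s k - digit_tail t k.
have dE k : d k = k%:R * (s - t) / ((k.+1%:R + s) * (k.+1%:R + t)).
  rewrite /d /digit_tail; have := natS_gt0 k s0; have := natS_gt0 k t0.
  rewrite -[k.+1%:R]natr1; move: (k%:R : R) => x p1 p2.
  by field; rewrite !gt_eqF.
pose X N := digit_psum s G N - digit_psum t G N.
(* Both tails equal 1 at 0, so [Y N] is the sum of [d k * (G k - G k.-1)] over 1 <= k <= N, and it
   differs from [X N.+1] by a boundary term tending to 0. *)
pose Y N := X N.+1 + d N.+1 * G N.
have Yle N : `|Y N| <= L * `|s - t| * (1 / 4 - (2 * (N.+1%:R * N.+2%:R))^-1).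
  elim: N => [|N IH].
    rewrite /Y /X /digit_psum !big_nat1 !digit_weightE //.
    have -> : digit_tail s 0 = 1 by rewrite /digit_tail divff // gt_eqF // ltr_pwDl.
    have -> : digit_tail t 0 = 1 by rewrite /digit_tail divff // gt_eqF // ltr_pwDl.
    rewrite (_ : _ + _ = 0) ?normr0; last by rewrite /d; ring.
    by rewrite mulr_ge0 ?mulr_ge0 // mul1r; lra.
  have -> : Y N.+1 = Y N + d N.+1 * (G N.+1 - G N).
    rewrite /Y /X /digit_psum !(big_nat_recr N.+1) //= !digit_weightE // /d; ring.
  apply: le_trans (ler_normD _ _) _.
  have : `|d N.+1 * (G N.+1 - G N)| <= L * `|s - t| * (N.+1%:R * N.+2%:R * N.+3%:R)^-1.
    rewrite normrM dE !normrM.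
    have := fL _ _ (next_state01 N.+1 t01) (next_state01 N t01).
    have e : next_state t N.+1 - next_state t N = - ((N.+1%:R + t) * (N.+2%:R + t))^-1.
      rewrite /next_state; have := natS_gt0 N t0; have := natS_gt0 N.+1 t0.
      rewrite -[N.+2%:R]natr1; move: (N.+1%:R : R) => x p1 p2.
      by field; rewrite !gt_eqF.
    rewrite e normrN => /(ler_wpM2l (normr_ge0 (N.+1%:R * (s - t) / ((N.+2%:R + s) * (N.+2%:R +
      t))))).
    rewrite !normrM => /le_trans; apply.
    have := normr_ge0 (s - t); move: (`|s - t|) => a a0.
    have p1 := natS_gt0 N t0; have p2 := natS_gt0 N.+1 t0; have p3 := natS_gt0 N.+1 s0.
    rewrite !ger0_norm ?invr_ge0 ?mulr_ge0 ?(ltW p1) ?(ltW p2) ?(ltW p3) //.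
    rewrite [leLHS](_ : _ = L * a * (N.+1%:R / ((N.+2%:R + s) * (N.+2%:R + t) * ((N.+1%:R + t)
      * (N.+2%:R + t))))); last first.
      by move: (N.+1%:R : R) (N.+2%:R : R) p1 p2 p3 => x y p1 p2 p3; field; rewrite !gt_eqF.
    rewrite ler_wpM2l ?mulr_ge0 //.
    have x1 : 1 <= N.+1%:R :> R by rewrite ler1n.
    move: p1 p2 p3; rewrite -[N.+3%:R]natr1 -[N.+2%:R]natr1; move: x1; move: (N.+1%:R : R).
    move=> x x1 p1 p2 p3.
    rewrite -[leRHS]div1r ler_pdivlMr ?mulr_gt0 //; try lra.
    rewrite mulrAC ler_pdivrMr ?mul1r ?mulr_gt0 //.
    rewrite (_ : x * _ = (x * (x + 1 + 1)) * (x * (x + 1))); last by ring.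
    by apply: ler_pM; rewrite ?mulr_ge0 //; nra.
  move/(lerD IH)/le_trans; apply.
  rewrite -mulrDr ler_wpM2l ?mulr_ge0 // le_eqVlt; apply/orP; left; apply/eqP.
  have : 0 < N.+1%:R :> R by rewrite ltr0n.
  rewrite -[N.+3%:R]natr1 -[N.+2%:R]natr1; move: (N.+1%:R : R) => x x0.
  by field; rewrite !gt_eqF //; lra.
have Ycvg : Y @ \oo --> digit_mean s G - digit_mean t G.
  rewrite -[X in _ --> X]addr0; apply: cvgD.
    have XX : X @ \oo --> digit_mean s G - digit_mean t G by apply: cvgB; exact: digit_mean_cvg.
    by move: XX; rewrite -(cvg_shiftS X).
  have [M HM] := bG.
  have d0 : d @ \oo --> (0 : R) by rewrite -[X in _ --> X](subrr 0); apply: cvgB;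
    exact: digit_tail_cvg0.
  have dM : (fun N => M * `|d N.+1|) @ \oo --> (0 : R).
    rewrite -[X in _ --> X](mulr0 M); apply: cvgMr; rewrite -(normr0 R); apply: cvg_norm.
    by move: d0; rewrite -(cvg_shiftS d).
  apply: (@squeeze_cvgr _ _ _ _ (fun N => - (M * `|d N.+1|)) (fun N => M * `|d N.+1|)) => //.
    by near=> N; rewrite -ler_norml normrM mulrC ler_wpM2r.
  by rewrite -[X in _ --> X]oppr0; exact: cvgN.
apply: (ler_cvg_to (cvg_norm Ycvg) (@cvg_cst _ _ _ _ _)); near=> N.
apply: (le_trans (Yle N)).
rewrite [leRHS](_ : _ = L * `|s - t| * (1 / 4)); last by ring.
by rewrite ler_wpM2l ?mulr_ge0 // gerBl invr_ge0 mulr_ge0.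
Unshelve. all: by end_near. Qed.

Lemma transfer_lip L f : 0 <= L -> lip01 L f -> lip01 (7 / 8 * L) (transfer f).
Proof.
move=> L0 fL s t s01 t01; have /andP[s0 s1] := s01.
have -> : transfer f s - transfer f t =
  digit_mean s (fun k => f (next_state s k) - f (next_state t k)) +
  (digit_mean s (fun k => f (next_state t k)) - digit_mean t (fun k => f (next_state t k))).
  rewrite digit_meanB //; [|exact: lip01_bounded_seq fL _|exact: lip01_bounded_seq fL _].
  by rewrite addrA subrK.
apply: le_trans (ler_normD _ _) _.
have := transfer_lip_diag L0 fL s01 t01; have := transfer_lip_weight L0 fL s01 t01; lra.
Qed.

End Contraction.

(** * Invariance of the Gauss measure and convergence of the iterates to 1/ln 2 *)

Section GaussMean.
Variable R : realType.
Implicit Types (s t : R) (k n N : nat) (f Phi Psi : R -> R).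

(** [Phi 1 - Phi 0] is the integral of f against the unnormalised Gauss density 1/(1+x). Working
    with primitives lets the mean value theorem replace integral estimates. *)
Definition gauss_primitive f Phi :=
  forall x : R, 0 <= x <= 1 -> is_derive x 1 Phi (f x / (1 + x)).

Lemma derive_bound_dist Phi (df : R -> R) M :
  (forall x : R, 0 <= x <= 1 -> is_derive x 1 Phi (df x)) ->
  (forall x : R, 0 <= x <= 1 -> `|df x| <= M) -> `|Phi 1 - Phi 0| <= M.
Proof.
move=> dPhi dM.
have [||c] := @MVT_segment R Phi df 0 1 ler01.
- by move=> x; rewrite in_itv /= => /andP[x0 x1]; apply: dPhi; rewrite !ltW.
- apply: derivable_within_continuous => x; rewrite in_itv /= => /dPhi h.
  exact: ex_derive.
by rewrite in_itv /= => c01 ->; rewrite subr0 mulr1; exact: dM.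
Qed.

(** Extends a function controlled only on [0,1] to a continuous function on the line. *)
Definition clamp01 (x : R) := if x < 0 then 0 else if 1 < x then 1 else x.

Lemma clamp01_itv x : 0 <= clamp01 x <= 1.
Proof. by rewrite /clamp01; case: (ltP x 0) => ?; case: (ltP 1 x) => ?; apply/andP;
  split => //; lra. Qed.

Lemma clamp01_id x : 0 <= x <= 1 -> clamp01 x = x.
Proof. by move=> /andP[x0 x1]; rewrite /clamp01 !ltNge x0 x1. Qed.

Lemma clamp01_dist x y : `|clamp01 x - clamp01 y| <= `|x - y|.
Proof.
have := ler_norm (x - y); have := ler_norm (y - x); rewrite (distrC y) ler_norml /clamp01.
by case: (ltP x 0) => ?; case: (ltP 1 x) => ?; case: (ltP y 0) => ?; case: (ltP 1 y) => ? ? ?;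
  lra.
Qed.

Lemma gauss_primitive_exists L f : 0 <= L -> lip01 L f -> exists Phi, gauss_primitive f Phi.
Proof.
move=> L0 fL; pose F x := f (clamp01 x) / (1 + clamp01 x).
have cc : continuous clamp01.
  move=> x; apply/cvgrPdist_le => e e0; near=> y.
  by apply: le_trans (clamp01_dist _ _) _; near: y; apply: cvgr_dist_le.
have cf : continuous (f \o clamp01).
  move=> x; apply/cvgrPdist_le => e e0; near=> y.
  apply: le_trans (fL _ _ (clamp01_itv _) (clamp01_itv _)) _.
  apply: (@le_trans _ _ (L * `|x - y|)); first by rewrite ler_wpM2l // clamp01_dist.
  have h : `|x - y| <= e / (L + 1).
    near: y; apply: cvgr_dist_le => //; rewrite divr_gt0 //; lra.
  have : L * `|x - y| <= L * (e / (L + 1)) by rewrite ler_wpM2l.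
  move/le_trans; apply; rewrite mulrA ler_pdivrMr; [nra|lra].
have cF : continuous F.
  move=> x; apply: cvgM; first exact: cf.
  apply: cvgV; first by have /andP[? ?] := clamp01_itv x; rewrite gt_eqF //; lra.
  by apply: cvgD; [exact: cvg_cst|exact: cc].
(* The base point -1 and the upper bound 2 used below keep 0 and 1 interior, so the derivative is
   two-sided there. *)
exists (fun x => \int[lebesgue_measure]_(t in `[-1, x]) F t)%R => x x01.
have /andP[x0 x1] := x01.
have [||||h1 h2] := @continuous_FTC1_closed R F (-1) x 2.
- by lra.
- apply: continuous_compact_integrable; first exact: segment_compact.
  exact: continuous_subspaceT.
- by lra.
- exact: cF.
apply: DeriveDef => //; rewrite -derive1E h2 /F clamp01_id //.
Unshelve. all: by end_near. Qed.

(** Invariance of the Gauss measure: the branches s -> 1/(k+1+s) tile (0,1], and each carries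
    dy/(1+y) to its share of ds/(1+s). *)
Lemma gauss_primitive_transfer L f Phi Psi : 0 <= L -> lip01 L f ->
  gauss_primitive f Phi -> gauss_primitive (transfer f) Psi -> Psi 1 - Psi 0 = Phi 1 - Phi 0.
Proof.
move=> L0 fL dPhi dPsi; pose M := `|f 0| + L.
have i0 : 0 <= (0 : R) <= 1 by rewrite lexx ler01.
have i1 : 0 <= (1 : R) <= 1 by rewrite lexx ler01.
have M0 : 0 <= M by rewrite addr_ge0.
(* A primitive of the N-th partial sum of the transfer. It vanishes at s = 0, and at s = 1 it
   telescopes to [Phi 1 - Phi N.+1%:R^-1]. *)
pose W N s := \sum_(k < N) (Phi (k.+1%:R^-1) - Phi (next_state s k)).
have dW N s : 0 <= s <= 1 ->
    is_derive s 1 (W N) (digit_psum s (fun k => f (next_state s k)) N / (1 + s)).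
  move=> s01; have /andP[s0 s1] := s01.
  have -> : W N = \sum_(k < N) (fun s => Phi (k.+1%:R^-1) - Phi (next_state s k)).
    by apply/funext => t; rewrite /W fct_sumE.
  rewrite /digit_psum big_mkord mulr_suml; apply: is_derive_sum => k.
  have p1 := natS_gt0 k s0; have p2 := natS_gt0 k.+1 s0.
  have d1 : is_derive s 1 (fun s => k.+1%:R + s : R) (0 + 1) by apply: is_deriveD.
  have d2 := @is_deriveV R _ s _ 1 (lt0r_neq0 p1) d1.
  have d3 := @is_derive1_comp R Phi (fun s => next_state s k) s _ _ (dPhi _ (next_state01 k
    s01)) d2.
  have -> : digit_weight s k * f (next_state s k) / (1 + s) =
    0 - f (next_state s k) / (1 + next_state s k) * (- (k.+1%:R + s) ^- 2 *: (0 + 1)).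
    rewrite /GRing.scale /= /digit_weight.
    move: (f _) => fs; rewrite /next_state.
    move: p1 p2; rewrite -[k.+2%:R]natr1; move: (k.+1%:R : R) => x p1 p2.
    by field; rewrite !gt_eqF //; lra.
  by apply: is_deriveB.
have bound N : `|(Psi 1 - Psi 0) - (Phi 1 - Phi N.+1%:R^-1)| <= M * (2 / N.+1%:R).
  have W0 : W N 0 = 0 by rewrite /W big1 // => k _; rewrite /next_state addr0 subrr.
  have W1 : W N 1 = Phi 1 - Phi N.+1%:R^-1.
    rewrite /W; elim: (N) => [|m IH]; first by rewrite big_ord0 invr1 subrr.
    by rewrite big_ord_recr /= IH /next_state natr1 addrA subrK.
  rewrite (_ : _ - _ = (Psi \- W N) 1 - (Psi \- W N) 0); last by rewrite /= W0 W1; ring.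
  apply: (@derive_bound_dist (Psi \- W N) (fun s => (transfer f s - digit_psum s (fun k => f
    (next_state s k)) N) / (1 + s))).
    by move=> s s01; rewrite mulrBl; apply: is_deriveB; [exact: dPsi|exact: dW].
  move=> s s01; have /andP[s0 s1] := s01.
  have fM k : `|f (next_state s k)| <= M by apply: lip01_bounded => //; exact: next_state01.
  have h := digit_psum_mean_dist N s01 fM.
  have h2 : M * digit_tail s N <= M * (2 / N.+1%:R) by rewrite ler_wpM2l // digit_tail_le.
  rewrite normrM normfV [`|1 + s|]ger0_norm ?addr_ge0 // ler_pdivrMr; last by rewrite ltr_pwDl.
  rewrite (le_trans h) // (le_trans h2) // ler_peMr ?lerDl // mulr_ge0 //.
have cPhi : Phi \o (fun N => N.+1%:R^-1) @ \oo --> Phi 0.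
  apply: (@cvg_comp _ _ _ (fun N => N.+1%:R^-1 : R) Phi \oo (nbhs (0 : R)));
    first exact: cvg_harmonic.
  have [h _] := dPhi 0 i0.
  by move/derivable1_diffP: h => h; exact: (differentiable_continuous h).
have c1 : (fun N => `|(Psi 1 - Psi 0) - (Phi 1 - Phi N.+1%:R^-1)|) @ \oo --> `|(Psi 1 - Psi 0)
  - (Phi 1 - Phi 0)|.
  by apply: cvg_norm; apply: cvgB; [exact: cvg_cst|apply: cvgB; [exact: cvg_cst|exact: cPhi]].
have c2 : (fun N => M * (2 / N.+1%:R)) @ \oo --> (0 : R).
  have : (fun N => M * (2 / N.+1%:R)) @ \oo --> M * (2 * (0 : R)).
    by apply: cvgMr; apply: cvgMr; exact: cvg_harmonic.
  by rewrite !mulr0.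
apply/eqP; rewrite -subr_eq0 -normr_le0.
by apply: (ler_cvg_to c1 c2); near=> N; exact: bound.
Unshelve. all: by end_near. Qed.

Definition iter_transfer n : R -> R := iter n (@transfer R) (fun s => 1 + s).

Lemma iter_transfer_lip n : lip01 ((7 / 8) ^+ n) (iter_transfer n).
Proof.
elim: n => [|n IH] /=.
  by move=> x y _ _; rewrite expr0 mul1r le_eqVlt; apply/orP; left; apply/eqP; congr `|_|; ring.
by rewrite exprS; apply: transfer_lip => //; rewrite exprn_ge0 //; lra.
Qed.

Lemma iter_transfer_primitive n :
  exists2 Phi, gauss_primitive (iter_transfer n) Phi & Phi 1 - Phi 0 = 1.
Proof.
have q0 m : 0 <= (7 / 8) ^+ m :> R by rewrite exprn_ge0 //; lra.
elim: n => [|n [Phi dPhi e]].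
  exists id; last by rewrite subr0.
  move=> x /andP[x0 x1]; rewrite /= divff; first exact: is_derive_id.
  by rewrite gt_eqF // ltr_pwDl.
have [Psi dPsi] := gauss_primitive_exists (q0 n.+1) (@iter_transfer_lip n.+1).
exists Psi; first exact: dPsi.
rewrite -[RHS]e; exact: (gauss_primitive_transfer (q0 n) (@iter_transfer_lip n) dPhi dPsi).
Qed.

                                                                                            
                          
(** The iterate keeps integral 1 against dx/(1+x), a measure of mass ln 2, and oscillates by at most
    (7/8)^n. Hence 1 - c ln 2 is at most (7/8)^n in absolute value for each value c, and dividing by
    ln 2 >= 1/2 gives the factor 2. *)
Lemma iter_transfer_near n s : 0 <= s <= 1 ->
  `|iter_transfer n s - (ln 2)^-1| <= 2 * (7 / 8) ^+ n.
Proof.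
move=> s01; have [Phi dPhi e] := iter_transfer_primitive n.
set c := iter_transfer n s.
have h : `|(Phi \- (fun x => c * ln (1 + x))) 1 - (Phi \- (fun x => c * ln (1 + x))) 0| <= (7 /
  8) ^+ n.
  apply: (@derive_bound_dist (Phi \- (fun x => c * ln (1 + x))) (fun x => iter_transfer n x /
    (1 + x) - c * ((1 + x)^-1 * (0 + 1)))).
    move=> x x01; have /andP[x0 x1] := x01; apply: is_deriveB; first exact: dPhi.
    have p : 0 < 1 + x by rewrite ltr_pwDl.
    have d1 : is_derive x 1 (fun x => 1 + x : R) (0 + 1) by apply: is_deriveD.
    have d2 := @is_derive1_comp R (@ln R) (fun x => 1 + x) x _ _ (is_derive1_ln p) d1.
    by have := is_deriveZ c d2.
  move=> x x01; have /andP[x0 x1] := x01.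
  rewrite add0r mulr1 -mulrBl normrM normfV [`|1 + x|]ger0_norm ?addr_ge0 //.
  rewrite ler_pdivrMr; last by rewrite ltr_pwDl.
  apply: le_trans (iter_transfer_lip n x01 s01) _.
  apply: ler_wpM2l; first by apply: exprn_ge0; lra.
  by have /andP[s0 s1] := s01; rewrite ler_norml; lra.
move: h; rewrite /= addr0 ln1 mulr0 subr0 (_ : Phi 1 - _ - _ = 1 - c * ln 2); last first.
  by rewrite -[1 + 1]/(2 : R); move: (Phi 1) (Phi 0) e => a b e; lra.
have l2 := ln2_ge R; have l0 : 0 < ln 2 :> R by lra.
move=> h; rewrite (_ : c - _ = - ((1 - c * ln 2) / ln 2)); last by field; rewrite gt_eqF.
rewrite normrN normrM normfV [`|ln 2|]gtr0_norm // ler_pdivrMr // (le_trans h) //.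
have : 0 <= (7 / 8) ^+ n :> R by rewrite exprn_ge0 //; lra.
move: ((7 / 8) ^+ n) => q q0; nra.
Qed.

End GaussMean.

                  

(** * Cylinder sets, their measure, and Borel-Cantelli for digit events *)

Section Cylinders.
Variable R : realType.
Implicit Types (w : seq nat) (x y z : R) (S : pred (seq nat)).

                                                                                 
(** Words list the shifted digits with the newest first, so that reading a digit is a [cons]. In
    terms of convergents, [word_state] is q_{n-1}/q_n, [word_weight] is 1/(q_n(q_n + q_{n-1})), and
    [word_map w y] is the inverse branch of the n-th iterate of the Gauss map. *)
Fixpoint word_state w : R := if w is k :: w' then next_state (word_state w') k else 0.

Fixpoint word_weight w : R :=
  if w is k :: w' then word_weight w' * digit_weight (word_state w') k else 1.

Fixpoint word_map w (y : R) : R := if w is k :: w' then word_map w' (next_state y k) else y.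

Lemma word_state01 w : 0 <= word_state w <= 1.
Proof. by elim: w => [|k w IH] /=; [rewrite lexx ler01|exact: next_state01]. Qed.

Lemma word_weight_ge0 w : 0 <= word_weight w.
Proof.
elim: w => [|k w IH] //=; rewrite mulr_ge0 // digit_weight_ge0 //.
by case/andP: (word_state01 w).
Qed.

(** The inverse branch is the Möbius map (p_n + y p_{n-1})/(q_n + y q_{n-1}) of determinant 1 or -1,
    and the weight times 1 + state is 1/q_n^2. *)
Lemma word_mapB w y z : 0 <= y -> 0 <= z ->
  word_map w y - word_map w z =
  (-1) ^+ size w * word_weight w * (1 + word_state w) * (y - z) / ((1 + word_state w * y) * (1
    + word_state w * z)).
Proof.
elim: w y z => [|k w IH] y z y0 z0 /=; first by rewrite expr0 !mul0r !addr0 !mul1r divr1.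
have py := natS_gt0 k y0; have pz := natS_gt0 k z0.
rewrite IH ?invr_ge0 ?(ltW py) ?(ltW pz) //.
have /andP[s0 s1] := word_state01 w; have ps := natS_gt0 k s0.
rewrite exprS /digit_weight /next_state; move: (_ ^+ _) (word_weight w) => e g.
move: ps py pz; rewrite -[k.+2%:R]natr1;
  move: (k.+1%:R : R) (word_state w) s0 => K s s0 ps py pz.
field; rewrite !gt_eqF //; lra.
Qed.

(** Each digit reverses the orientation of the inverse branch, hence the case on parity. The closed
    interval may exceed the set of points with these digits by endpoints, which is harmless for
    upper bounds. *)
Definition cylinder w : set R :=
  if odd (size w) then `[word_map w 0 - word_weight w, word_map w 0]
  else `[word_map w 0, word_map w 0 + word_weight w].

Lemma cylinder_measure w : lebesgue_measure (cylinder w) = (word_weight w)%:E.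
Proof.
have := word_weight_ge0 w; rewrite le_eqVlt => /orP[/eqP e|w0].
  rewrite /cylinder; case: ifP => _; rewrite lebesgue_measure_itv /= -e ?subr0 ?addr0 ltxx //.
rewrite /cylinder; case: ifP => _; rewrite lebesgue_measure_itv /= lte_fin.
  by rewrite ltrBlDr ltrDl w0 EFinN -EFinB; congr EFin; ring.
by rewrite ltrDl w0 -EFinB; congr EFin; ring.
Qed.

Lemma measurable_cylinder w : measurable (cylinder w).
Proof. by rewrite /cylinder; case: ifP => _; exact: measurable_itv. Qed.

Lemma word_map_cylinder w y : 0 <= y <= 1 -> cylinder w (word_map w y).
Proof.
move=> /andP[y0 y1]; have /andP[s0 s1] := word_state01 w.
have := word_mapB w y0 (lexx 0); rewrite mulr0 addr0 subr0 mulr1 -signr_odd.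
have := word_weight_ge0 w; rewrite /cylinder.
move: (word_map w y) (word_map w 0) (word_weight w) (word_state w) s0 s1 => a b g s s0 s1 g0.
have p : 0 < 1 + s * y by rewrite ltr_pwDl // mulr_ge0.
have h : 0 <= (1 + s) * y / (1 + s * y) <= 1.
  apply/andP; split; last by rewrite ler_pdivrMr //; nra.
  by apply: divr_ge0; [apply: mulr_ge0 => //; lra|exact: ltW].
rewrite -!mulrA [_ * (y / _)]mulrA; move: h; move: ((1 + s) * y / _) => q /andP[q0 q1].
by case: (odd _); rewrite ?expr1 ?expr0 => e; rewrite /= in_itv /=; apply/andP; split; nra.
Qed.

(** The event, seen from the prefix [w], that [S] holds after n further digits, written as nested
    countable unions so that its measure can be bounded one digit at a time. *)
Fixpoint descend n S w : set R :=
  if n is m.+1 then \bigcup_k descend m S (k :: w) else if S w then cylinder w else set0.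

Lemma measurable_descend n S w : measurable (descend n S w).
Proof.
elim: n w => [|n IH] w /=; first by case: ifP => _ //; exact: measurable_cylinder.
exact: bigcup_measurable.
Qed.

                                                                                             
                               
(** [V m v] majorises the conditional probability, given [v], that [S] holds m digits later: it
    dominates the indicator at m = 0 and its mean over one more digit does not exceed it. Countable
    subadditivity carries this back along the word. *)
Lemma descend_measure_le S (V : nat -> seq nat -> R) n w :
  (forall m v, 0 <= V m v) ->
  (forall v, S v -> 1 <= V 0%N v) ->
  (forall m v N, digit_psum (word_state v) (fun k => V m (k :: v)) N <= V m.+1 v) ->
  (lebesgue_measure (descend n S w) <= (word_weight w * V n w)%:E)%E.
Proof.
move=> V0 SV stepV; elim: n w => [|n IH] w /=.
  case: ifP => Sw; last by rewrite measure0 lee_fin mulr_ge0 // word_weight_ge0.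
  by rewrite cylinder_measure lee_fin ler_peMr ?word_weight_ge0 // SV.
apply: (@le_trans _ _ (\sum_(0 <= k <oo) lebesgue_measure (descend n S (k :: w)))%E).
  apply: measure_sigma_subadditive => //.
  - by move=> k; exact: measurable_descend.
  - by apply: bigcup_measurable => k _; exact: measurable_descend.
apply: lime_le; first exact: is_cvg_nneseries.
near=> N.
apply: (@le_trans _ _ (\sum_(0 <= k < N) (word_weight (k :: w) * V n (k :: w))%:E)%E).
  by apply: lee_sum => k _; exact: IH.
rewrite sumEFin lee_fin; apply: le_trans (ler_wpM2l (word_weight_ge0 w) (stepV n w N)).
rewrite /digit_psum mulr_sumr; apply: ler_sum => k _ /=. by rewrite -mulrA.
Unshelve. all: by end_near. Qed.

Definition infinite_cf (x : R) := 0 < x <= 1 /\ forall n, iter n (@gauss R) x != 0.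

Lemma gauss01 y : 0 < y -> 0 <= gauss y < 1.
Proof.
move=> y0; rewrite /gauss gt_eqF //.
have /andP[h1 h2] := truncn_itv (ltW (etrans (invr_gt0 y) y0)).
by rewrite subr_ge0 h1 /= ltrBlDr addrC natr1.
Qed.

Lemma iter_gauss01 x n : infinite_cf x -> 0 < iter n (@gauss R) x <= 1.
Proof.
move=> [x01 nt]; elim: n => [|n /andP[IH _]] //=.
have /andP[h1 h2] := gauss01 IH; rewrite lt_neqAle h1 eq_sym (nt n.+1) /=; exact: ltW.
Qed.

Fixpoint cf_word n (x : R) : seq nat :=
  if n is m.+1 then (cf_digit m.+1 x).-1 :: cf_word m x else [::].

Lemma size_cf_word n x : size (cf_word n x) = n.
Proof. by elim: n => //= n ->. Qed.

Lemma cf_digit_gt0 x n : infinite_cf x -> (0 < cf_digit n.+1 x)%N.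
Proof.
move=> xI; rewrite /cf_digit /=; have /andP[y0 y1] := iter_gauss01 n xI.
by rewrite gt_eqF // truncn_gt0 invf_ge1.
Qed.

Lemma cf_word_map x n : infinite_cf x -> word_map (cf_word n x) (iter n (@gauss R) x) = x.
Proof.
move=> xI; elim: n => //= n; congr (_ = _); congr word_map.
have := cf_digit_gt0 n xI; rewrite /cf_digit /= /next_state.
have /andP[y0 y1] := iter_gauss01 n xI; rewrite /gauss gt_eqF // => d0.
by rewrite prednK // addrC subrK invrK.
Qed.

Lemma cf_word_cylinder x n : infinite_cf x -> cylinder (cf_word n x) x.
Proof.
move=> xI; rewrite -{2}(cf_word_map n xI); apply: word_map_cylinder.
by have /andP[/ltW -> ->] := iter_gauss01 n xI.
Qed.

Lemma cf_word_descend x n S m : infinite_cf x -> S (cf_word (n + m) x) -> descend n S (cf_word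
  m x) x.
Proof.
move=> xI; elim: n m => [|n IH] m Sx /=.
  by rewrite Sx; exact: cf_word_cylinder.
by exists (cf_digit m.+1 x).-1 => //; apply: (IH m.+1); rewrite addnS.
Qed.

Lemma cf_borel_cantelli (S : nat -> pred (seq nat)) (n_ : nat -> nat) (b : nat -> R) :
  (forall j, (lebesgue_measure (descend (n_ j) (S j) [::]) <= (b j)%:E)%E) ->
  (exists M, forall N, \sum_(0 <= j < N) b j <= M) ->
  {ae lebesgue_measure, forall x, infinite_cf x -> exists J, forall j, (J <= j)%N -> ~~ S j
    (cf_word (n_ j) x)}.
Proof.
move=> hb [M hM]; pose F j := descend (n_ j) (S j) [::].
have mF j : measurable (F j) by exact: measurable_descend.
have F0 : lebesgue_measure (lim_sup_set F) = 0%E.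
  apply: lim_sup_set_cvg0 => //; apply: (@le_lt_trans _ _ M%:E); last exact: ltry.
  apply: lime_le; first exact: is_cvg_nneseries.
  near=> N; apply: (@le_trans _ _ (\sum_(0 <= j < N) (b j)%:E)%E).
    by apply: lee_sum => j _; exact: hb.
  by rewrite sumEFin lee_fin.
exists (lim_sup_set F); split => //.
  apply: bigcapT_measurable => n; apply: bigcup_measurable => j _; exact: mF.
move=> x /= /not_implyP[xI /forallNP hx] n _.
have /existsNP[j] := hx n; move=> /not_implyP[nj /negP]; rewrite negbK => Sj.
by exists j => //; apply: (@cf_word_descend x (n_ j) (S j) 0%N) => //; rewrite addn0.
Unshelve. all: by end_near. Qed.

(** If [gauss y] is rational then so is [y]; an orbit reaching 0 therefore starts at a rational, and
    the rationals are countable. *)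
Lemma not_infinite_cf_negligible : {ae @lebesgue_measure R, forall x : R, x \in `]0, 1] ->
  infinite_cf x}.
Proof.
have cQ : countable (range (@ratr R)) by apply: sub_countable (card_image_le _ _) (countableP
  _).
exists (range (@ratr R)); split.
- by apply: countable_measurable => // y; exact: measurable_set1.
- exact: countable_lebesgue_measure0.
move=> x /= /not_implyP[x01 nI].
have {}nI : exists n, iter n (@gauss R) x = 0.
  apply: contrapT => /forallNP h; apply: nI; split; last by move=> n; apply/eqP; exact: h.
  by move: x01; rewrite inE /= in_itv.
have [n] := nI.
have H : forall y : R, range (@ratr R) (gauss y) -> range (@ratr R) y.
  move=> y [q _ e]; have [->|y0] := eqVneq y 0; first by exists 0 => //; rewrite rmorph0.
  exists ((q + (Num.truncn y^-1)%:R)^-1) => //.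
  by rewrite fmorphV rmorphD /= e rmorph_nat /gauss (negbTE y0) subrK invrK.
have : range (@ratr R) 0 by exists 0 => //; rewrite rmorph0.
move=> r0 e; have : range (@ratr R) (iter n (@gauss R) x) by rewrite e.
by elim: n {e} => //= n IH /H.
Qed.

End Cylinders.

                              

(** * Deviation bounds for additive functionals of the digits *)

Section DigitSums.
Variable R : realType.
Implicit Types (w : seq nat) (s x t : R) (F : R -> nat -> R) (n K N M : nat).

(** [F] receives the state before the digit is read, so subtracting its mean under [digit_weight]
    produces martingale differences ([centered]). *)
Fixpoint word_sum F w : R :=
  if w is k :: w' then word_sum F w' + F (word_state R w') k else 0.

Lemma word_sumD F G w : word_sum (fun s k => F s k + G s k) w = word_sum F w + word_sum G w.
Proof. by elim: w => [|k w IH] /=; rewrite ?addr0 // IH addrACA. Qed.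

Lemma word_sumB F G w : word_sum (fun s k => F s k - G s k) w = word_sum F w - word_sum G w.
Proof. by elim: w => [|k w IH] /=; rewrite ?subr0 // IH opprD addrACA. Qed.

Lemma word_sumZ c F w : word_sum (fun s k => c * F s k) w = c * word_sum F w.
Proof. by elim: w => [|k w IH] /=; rewrite ?mulr0 // IH mulrDr. Qed.

Lemma word_sum_norm F C w : (forall s k, 0 <= s <= 1 -> `|F s k| <= C) ->
  `|word_sum F w| <= (size w)%:R * C.
Proof.
move=> h; elim: w => [|k w IH] /=; first by rewrite normr0 mul0r.
apply: le_trans (ler_normD _ _) _.
by rewrite -natr1 mulrDl mul1r lerD // h // word_state01.
Qed.

Lemma eq_word_sum F G w : (forall s k, 0 <= s <= 1 -> F s k = G s k) -> word_sum F w = word_sum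
  G w.
Proof. by move=> h; elim: w => [|k w IH] //=; rewrite IH h // word_state01. Qed.

Definition centered F s k : R := F s k - digit_mean s (F s).

(** Chebyshev's inequality for a martingale: the majorant is (z^2 + m sigma)/t^2, with z the current
    sum and m the number of digits still to come. *)
Lemma word_sum_centered_tail F (sigma t : R) n : 0 < t -> 0 <= sigma ->
  (forall s, 0 <= s <= 1 -> bounded_seq (F s)) ->
  (forall s, 0 <= s <= 1 -> digit_mean s (fun k => F s k ^+ 2) <= sigma) ->
  (lebesgue_measure (descend n (fun w => t < `|word_sum (centered F) w|)%R [::] : set R) <=
    (n%:R * sigma / t ^+ 2)%:E)%E.
Proof.
move=> t0 sg0 bF hF; have t2 : 0 < t ^+ 2 by rewrite exprn_gt0.
pose V m w := (word_sum (centered F) w ^+ 2 + m%:R * sigma) / t ^+ 2.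
have := @descend_measure_le R (fun w => t < `|word_sum (centered F) w|) V n [::].
rewrite /= mul1r /V /= expr0n /= add0r; apply.
- by move=> m v; rewrite divr_ge0 ?(ltW t2) // addr_ge0 ?sqr_ge0 // mulr_ge0.
- move=> v h; rewrite mul0r addr0 ler_pdivlMr // mul1r -[leRHS]real_normK ?num_real //.
  by have h' := ltW h; have t0' := ltW t0; rewrite !expr2 ler_pM.
move=> m v N; have s01 := word_state01 R v; have /andP[s0 s1] := s01.
set s := word_state R v in s01 s0 s1 *; set z := word_sum _ v.
have bz : bounded_seq (fun k => (z + (F s k - digit_mean s (F s))) ^+ 2).
  have b : bounded_seq (fun k => z + (F s k - digit_mean s (F s))).
    apply: bounded_seqD; first exact: bounded_seq_cst.
    by apply: bounded_seqB; [exact: bF|exact: bounded_seq_cst].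
  by apply: bounded_seqM.
have bc : bounded_seq (fun _ : nat => m%:R * sigma) by exact: bounded_seq_cst.
apply: (le_trans (digit_psum_le_mean _ s0 _ _)).
- under eq_fun do rewrite mulrC.
  apply: bounded_seqM; first exact: bounded_seq_cst.
  exact: bounded_seqD.
- by move=> k; rewrite divr_ge0 ?(ltW t2) // addr_ge0 ?sqr_ge0 // mulr_ge0.
under eq_fun do rewrite mulrC.
rewrite digit_meanZ //; last exact: bounded_seqD.
rewrite mulrC ler_pM2r ?invr_gt0 // digit_meanD // digit_mean_cst //.
have := digit_mean_sqr z s01 (bF s s01); have := hF s s01.
by rewrite -natr1; lra.
Qed.

(** A union bound: each digit still to come adds at most [tau] to the majorant. *)
Lemma has_digit_tail (B : pred nat) (tau : R) n :
  (forall s N, 0 <= s <= 1 -> digit_psum s (fun k => (B k)%:R) N <= tau) ->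
  (lebesgue_measure (descend n (has B) [::] : set R) <= (n%:R * tau)%:E)%E.
Proof.
move=> hB; pose V m w := (has B w)%:R + m%:R * tau : R.
have tau0 : 0 <= tau.
  have := hB 0 0%N; rewrite lexx ler01 /digit_psum big_geq //; exact.
have := @descend_measure_le R (has B) V n [::].
rewrite /= mul1r /V /= add0r; apply.
- by move=> m v; rewrite addr_ge0 // mulr_ge0.
- by move=> v ->; rewrite mul0r addr0.
move=> m v N; have s01 := word_state01 R v; have /andP[s0 s1] := s01.
set c := (has B v)%:R + m%:R * tau.
have c0 : 0 <= c by rewrite addr_ge0 // mulr_ge0.
apply: (@le_trans _ _ (digit_psum (word_state R v) (fun k => (B k)%:R) N + c * \sum_(0 <= k <
  N) digit_weight (word_state R v) k)).
  rewrite /digit_psum mulr_sumr -big_split /=; apply: ler_sum => k _.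
  rewrite [c * _]mulrC -mulrDr ler_wpM2l ?digit_weight_ge0 // /c addrA lerD2r.
  by case: (B k); case: (has B v) => /=; lra.
rewrite sum_digit_weight //.
have := hB _ N s01; have := digit_tail_ge0 N s0.
have : c * (1 - digit_tail (word_state R v) N) <= c by rewrite ler_piMr // gerBl digit_tail_ge0.
by rewrite /c -natr1; lra.
Qed.

Definition trunc_prime K (k : nat) : R := if prime k.+1 && (k.+1 <= K)%N then k.+1%:R else 0.
Definition large_prime K (k : nat) := prime k.+1 && (K < k.+1)%N.

Lemma sum_prime_shift (G : nat -> R) N :
  \sum_(0 <= k < N) (if prime k.+1 then G k.+1 else 0) = prime_sum G N.
Proof. by rewrite /prime_sum [in RHS](big_mkcond prime) big_nat_recl //= add0r. Qed.

Lemma trunc_prime_bounded K : bounded_seq (trunc_prime K).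
Proof.
exists K%:R => k; rewrite /trunc_prime; case: ifP => [/andP[_ h]|_]; last by rewrite normr0.
by rewrite ger0_norm // ler_nat.
Qed.

Lemma trunc_prime_mean s K (e : nat) : 0 <= s -> (0 < e)%N ->
  digit_mean s (fun k => trunc_prime K k ^+ e) = prime_sum (fun p => digit_weight s p.-1 * p%:R
    ^+ e) K.
Proof.
move=> s0 e0; rewrite (@digit_mean_finite _ _ _ K) //; last first.
  by move=> k Kk; rewrite /trunc_prime ltnNge Kk andbF expr0n eqn0Ngt e0.
rewrite -sum_prime_shift /digit_psum; apply: eq_big_nat => k /andP[_ kK].
by rewrite /trunc_prime kK andbT; case: ifP => _ //; rewrite expr0n eqn0Ngt e0 mulr0.
Qed.

Lemma digit_weight_sqr_le s p : 0 <= s <= 1 -> (0 < p)%N -> digit_weight s p.-1 <= 2 * p%:R ^-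
  2.
Proof.
move=> /andP[s0 s1]; case: p => // p _ /=; rewrite /digit_weight.
have := natS_gt0 p s0; have := natS_gt0 p.+1 s0; have : 0 < p.+1%:R :> R by rewrite ltr0n.
rewrite -[p.+2%:R]natr1; move: (p.+1%:R : R) => y y0 p1 p2.
rewrite ler_pdivrMr ?mulr_gt0 // mulrAC ler_pdivlMr ?exprn_gt0 //.
rewrite expr2; have : (1 + s) * (y * y) <= 2 * (y * y) by rewrite ler_wpM2r ?mulr_ge0 ?(ltW y0)
  //; lra.
have : y * y <= (y + s) * (y + 1 + s) by apply: ler_pM; lra.
lra.
Qed.

(** The weight of the digit p is at most 2/p^2 and cancels p^2, which leaves a count of primes. *)
Lemma trunc_prime_sqr_le s K : 0 <= s <= 1 ->
  digit_mean s (fun k => trunc_prime K k ^+ 2) <= 2 * prime_sum (fun=> 1) K.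
Proof.
move=> s01; have /andP[s0 _] := s01; rewrite trunc_prime_mean // -prime_sumZ.
apply: prime_sum_le => p pp _; have p0 := prime_gt0 pp.
by rewrite mulr1 -ler_pdivlMr ?exprn_gt0 ?ltr0n // digit_weight_sqr_le.
Qed.

Lemma sum_prime_sqr_le1 N : prime_sum (fun p => p%:R ^- 2) N <= 1 :> R.
Proof.
case: N => [|N]; first by rewrite /prime_sum (big_mkcond prime) big_nat1.
apply: (@le_trans _ _ (1 - N.+1%:R^-1)); last by rewrite gerBl invr_ge0.
elim: N => [|N IH].
  by rewrite /prime_sum (big_mkcond prime) !big_nat_recr //= big_geq //; lra.
rewrite prime_sumS.
apply: (@le_trans _ _ (1 - N.+1%:R^-1 + N.+2%:R ^- 2)).
  by rewrite lerD //; case: ifP => // _; rewrite invr_ge0 exprn_ge0.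
have : 0 < N.+1%:R :> R by rewrite ltr0n.
rewrite -[N.+2%:R]natr1; move: (N.+1%:R : R) => y y0.
rewrite -subr_ge0 (_ : _ - _ = (y * (y + 1) ^+ 2)^-1); last by field; rewrite !gt_eqF //; lra.
by rewrite invr_ge0 mulr_ge0 ?(ltW y0) // sqr_ge0.
Qed.

(** For each prime, p times its weight falls short of (1+s)/p by at most 8/p^2, and the sum of 1/p^2
    over primes is at most 1. *)
Lemma trunc_prime_mean_near s K : 0 <= s <= 1 ->
  `|digit_mean s (trunc_prime K) - (1 + s) * prime_sum (fun p => p%:R^-1) K| <= 8.
Proof.
move=> s01; have /andP[s0 s1] := s01.
have -> : digit_mean s (trunc_prime K) = prime_sum (fun p => digit_weight s p.-1 * p%:R ^+ 1) K.
  by rewrite -trunc_prime_mean.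
have h p : prime p -> 0 <= (1 + s) * p%:R^-1 - digit_weight s p.-1 * p%:R ^+ 1 <= 8 * p%:R ^- 2.
  move=> pp; have := prime_gt1 pp; case: p {pp} => // p p2; rewrite expr1 /digit_weight /=.
  have := natS_gt0 p s0; have := natS_gt0 p.+1 s0; have : 2 <= p.+1%:R :> R by rewrite ler_nat.
  rewrite -[p.+2%:R]natr1; move: (p.+1%:R : R) => y y2 p1 p0.
  have y0 : 0 < y by lra.
  rewrite (_ : _ - _ = (1 + s) * (y * (1 + 2 * s) + s * (1 + s)) / (y * ((y + s) * (y + 1 +
    s)))); last first.
    by field; rewrite !gt_eqF.
  apply/andP; split.
    by rewrite divr_ge0 ?mulr_ge0 ?(ltW y0) ?(ltW p1) ?(ltW p0) //; nra.
  rewrite ler_pdivrMr ?mulr_gt0 //.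
  rewrite (_ : 8 / y ^+ 2 * _ = 8 * ((y + s) * (y + 1 + s)) / y); last by field; rewrite gt_eqF.
  rewrite ler_pdivlMr //.
  have h1 : y * y <= (y + s) * (y + 1 + s) by apply: ler_pM; lra.
  have h2 : (1 + s) * (y * (1 + 2 * s) + s * (1 + s)) <= 2 * (4 * y).
    by apply: ler_pM; nra.
  have : (1 + s) * (y * (1 + 2 * s) + s * (1 + s)) * y <= 2 * (4 * y) * y by rewrite ler_wpM2r
    // ltW.
  lra.
rewrite distrC -prime_sumZ.
have -> : prime_sum (fun p => (1 + s) * p%:R^-1) K - prime_sum (fun p => digit_weight s p.-1 *
  p%:R ^+ 1) K =
  prime_sum (fun p => (1 + s) * p%:R^-1 - digit_weight s p.-1 * p%:R ^+ 1) K.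
  by rewrite /prime_sum -sumrB.
rewrite ger0_norm; last by apply: sumr_ge0 => p /h /andP[].
apply: (@le_trans _ _ (8 * prime_sum (fun p => p%:R ^- 2) K)).
  by rewrite -prime_sumZ; apply: prime_sum_le => p /h /andP[].
by rewrite -[leRHS]mulr1 ler_pM2l // sum_prime_sqr_le1.
Qed.

Lemma large_prime_psum_le s K N : 0 <= s <= 1 -> (2 <= K)%N ->
  digit_psum s (fun k => (large_prime K k)%:R) N <= 8 / (K%:R * ln K%:R).
Proof.
move=> s01 K2; have /andP[s0 s1] := s01.
have -> : digit_psum s (fun k => (large_prime K k)%:R) N =
    prime_sum (fun p => if (K < p)%N then digit_weight s p.-1 else 0) N.
  rewrite -sum_prime_shift /digit_psum; apply: eq_bigr => k _.
  by rewrite /large_prime; case: (prime _) => //=; rewrite ?mulr0 //; case: ifP => _;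
    rewrite ?mulr1 ?mulr0.
have r0 : 0 <= 8 / (K%:R * ln K%:R) :> R by rewrite divr_ge0 // mulr_ge0 // ln_nat_ge0.
have [KN|NK] := leqP K N; last first.
  rewrite /prime_sum big_nat_cond big1 // => p /andP[/andP[_ pN] _].
  by rewrite ifF //; apply/negbTE; rewrite -leqNgt; apply: leq_trans (ltnW NK).
apply: (@le_trans _ _ (2 * prime_sum (fun p => if (K < p)%N then p%:R ^- 2 else 0) N)).
  rewrite -prime_sumZ; apply: prime_sum_le => p pp _; case: ifP => _; rewrite ?mulr0 //.
  by apply: digit_weight_sqr_le => //; exact: prime_gt0.
by have := @prime_tail_le R K N K2 KN; lra.
Qed.

(** A truncated Neumann series: it solves the Poisson equation for 1+s up to the M-th iterate, which
    is close to 1/ln 2. *)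
Definition potential M s : R := \sum_(m < M) iter_transfer m s.

Lemma iter_transfer_norm n s : 0 <= s <= 1 -> `|iter_transfer n s| <= 4.
Proof.
move=> s01; have := iter_transfer_near n s01.
have q : (7 / 8) ^+ n <= 1 :> R by apply: exprn_ile1; lra.
have : (ln 2)^-1 <= 2 :> R by rewrite -[2%:R in leRHS]invrK lef_pV2 ?posrE ?invr_gt0 //;
  have := ln2_ge R; lra.
have : 0 <= (ln 2)^-1 :> R by rewrite invr_ge0; have := ln2_ge R; lra.
rewrite !ler_norml; lra.
Qed.

Lemma potential_norm M s : 0 <= s <= 1 -> `|potential M s| <= 4 * M%:R.
Proof.
move=> s01; apply: le_trans (ler_norm_sum _ _ _) _.
apply: (@le_trans _ _ (\sum_(m < M) 4)); first by apply: ler_sum => m _;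
  exact: iter_transfer_norm.
by rewrite sumr_const card_ord mulr_natr.
Qed.

                                                                        
Lemma potential_mean M s : 0 <= s <= 1 ->
  digit_mean s (fun k => potential M (next_state s k)) = potential M s - (1 + s) +
    iter_transfer M s.
Proof.
move=> s01; have /andP[s0 s1] := s01.
elim: M => [|M IH].
  have -> : (fun k => potential 0 (next_state s k)) = fun=> 0.
    by apply/funext => k; rewrite /potential big_ord0.
  by rewrite digit_mean_cst // /potential big_ord0 /=; ring.
have -> : (fun k => potential M.+1 (next_state s k)) =
    (fun k => potential M (next_state s k) + iter_transfer M (next_state s k)).
  by apply/funext => k; rewrite /potential big_ord_recr.
rewrite digit_meanD //.
- by rewrite IH /potential big_ord_recr /=; rewrite -/(transfer _ _); ring.
- by exists (4 * M%:R) => k; apply: potential_norm; exact: next_state01.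
- by exists 4 => k; apply: iter_transfer_norm; exact: next_state01.
Qed.

(** Summing the Poisson equation along the word leaves a centered sum, a telescoped boundary term of
    size at most 2 * 4M, and an error of at most 2 (7/8)^M per digit. *)
Lemma word_sum_state_near M w :
  `|word_sum (fun s _ => 1 + s) w - (size w)%:R / ln 2| <=
  `|word_sum (centered (fun s k => potential M (next_state s k))) w| + 8 * M%:R + (size w)%:R *
    (2 * (7 / 8) ^+ M).
Proof.
have tel : word_sum (fun s k => potential M (next_state s k) - potential M s) w = potential M
  (word_state R w) - potential M 0.
  by elim: w => [|k w IH] /=; rewrite ?subrr // IH; ring.
have cst : word_sum (fun _ _ => (ln 2)^-1) w = (size w)%:R / ln 2.
  elim: w {tel} => [|k w IH] /=; first by rewrite mul0r.
  by rewrite IH -[(size w).+1%:R]natr1 mulrDl mul1r.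
have e : word_sum (centered (fun s k => potential M (next_state s k))) w =
    potential M (word_state R w) - potential M 0 + (word_sum (fun s _ => 1 + s) w - (size w)%:R
      / ln 2)
    - word_sum (fun s _ => iter_transfer M s - (ln 2)^-1) w.
  rewrite -tel -cst -!word_sumB -word_sumD -word_sumB; apply: eq_word_sum => s k s01.
  by rewrite /centered potential_mean //; ring.
have h1 : `|word_sum (fun s _ => iter_transfer M s - (ln 2)^-1) w| <= (size w)%:R * (2 * (7 /
  8) ^+ M).
  by apply: word_sum_norm => s k s01; exact: iter_transfer_near.
have h2 := potential_norm M (word_state01 R w).
have h3 : `|potential M 0| <= 4 * M%:R by apply: potential_norm; rewrite lexx ler01.
have := ler_norm (word_sum (centered (fun s k => potential M (next_state s k))) w).
have := ler_norm (- word_sum (centered (fun s k => potential M (next_state s k))) w).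
move: e h1 h2 h3; rewrite normrN !ler_norml.
by move=> e /andP[? ?] /andP[? ?] /andP[? ?] ? ?; lra.
Qed.

(** When no prime exceeds the cap, the sum splits into a centered part, the gap between conditional
    means and (1+s)m (at most 8 per digit), and m times the sum of 1+s, where m is the sum of 1/p up
    to K. *)
Lemma word_sum_prime_near K M w : ~~ has (large_prime K) w ->
  `|word_sum (fun _ k => if prime k.+1 then k.+1%:R else 0) w
    - (size w)%:R / ln 2 * prime_sum (fun p => p%:R^-1) K| <=
  `|word_sum (centered (fun=> trunc_prime K)) w| + 8 * (size w)%:R +
  prime_sum (fun p => p%:R^-1) K *
  (`|word_sum (centered (fun s k => potential M (next_state s k))) w| + 8 * M%:R + (size w)%:R
    * (2 * (7 / 8) ^+ M)).
Proof.
move=> small.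
have -> : word_sum (fun _ k => if prime k.+1 then k.+1%:R else 0) w = word_sum (fun=>
  trunc_prime K) w.
  elim: w small => //= k w IH; rewrite negb_or => /andP[hk /IH ->]; congr (_ + _).
  by move: hk; rewrite /large_prime /trunc_prime; case: (prime _) => //=; rewrite -leqNgt => ->.
set m := prime_sum _ K.
have m0 : 0 <= m by apply: sumr_ge0 => p _; rewrite invr_ge0.
have hS := word_sum_state_near M w.
set err := _ + _ + _ in hS *.
have h2 : `|word_sum (fun s _ => digit_mean s (trunc_prime K) - (1 + s) * m) w| <= (size w)%:R
  * 8.
  by apply: word_sum_norm => s k s01; exact: trunc_prime_mean_near.
have e : word_sum (fun=> trunc_prime K) w - (size w)%:R / ln 2 * m =
  word_sum (centered (fun=> trunc_prime K)) w + word_sum (fun s _ => digit_mean s (trunc_prime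
    K) - (1 + s) * m) w
  + m * (word_sum (fun s _ => 1 + s) w - (size w)%:R / ln 2).
  rewrite mulrBr -word_sumZ.
  have -> : word_sum (fun=> trunc_prime K) w = word_sum (centered (fun=> trunc_prime K)) w +
     word_sum (fun s _ => digit_mean s (trunc_prime K) - (1 + s) * m) w + word_sum (fun s _ =>
       m * (1 + s)) w.
    by rewrite -!word_sumD; apply: eq_word_sum => s k s01; rewrite /centered; ring.
  ring.
rewrite e; apply: (le_trans (ler_normD _ _)); apply: (le_trans (lerD (ler_normD _ _) (lexx _))).
rewrite normrM (ger0_norm m0); have := ler_wpM2l m0 hS; lra.
Qed.

End DigitSums.

                                     

(** * Almost sure convergence along the ends of the blocks *)

Section Blocks.
Variable R : realType.
Implicit Types (j K N M : nat) (e x : R).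

Definition log_nbar j : R := j%:R * ln j%:R ^+ 2.
Definition norming j : R := nbar R j * ln (ln (nbar R j)) / ln 2.
Definition block_end j : nat := Num.truncn (nbar R j).
(** The cap is the norming itself: high enough that eventually no prime digit of the block exceeds
    it, low enough for the second moment of the capped sum. *)
Definition cutoff j : nat := Num.truncn (norming j).

Lemma ln2_gt0 : 0 < ln 2 :> R. Proof. by have := ln2_ge R; lra. Qed.

Lemma nbarE j : (0 < j)%N -> nbar R j = expR (log_nbar j).
Proof. by rewrite /nbar lt0n => /negbTE ->. Qed.

Lemma ln_nbar j : (0 < j)%N -> ln (nbar R j) = log_nbar j.
Proof. by move=> j0; rewrite nbarE // expRK. Qed.

Lemma ln_nat_ge j : (8 <= j)%N -> 3 / 2 <= ln j%:R :> R.
Proof.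
move=> j8; apply: (@le_trans _ _ (ln 8)).
  rewrite (_ : 8 = 2 ^+ 3) ?lnXn //; last by rewrite -natrX.
  by rewrite -mulr_natl; have := ln2_ge R; lra.
by rewrite ler_ln ?posrE ?ltr0n ?ler_nat //; lia.
Qed.

Lemma log_nbar_ge j : (8 <= j)%N -> j%:R <= log_nbar j.
Proof.
move=> j8; have := ln_nat_ge j8; rewrite /log_nbar => h.
by rewrite ler_peMr // expr_ge1 //; lra.
Qed.

Lemma log_nbar_ge8 j : (8 <= j)%N -> 8 <= log_nbar j.
Proof. by move=> j8; apply: le_trans (log_nbar_ge j8); rewrite ler_nat. Qed.

Lemma ln_log_nbar_ge j : (8 <= j)%N -> ln j%:R <= ln (log_nbar j).
Proof.
move=> j8; rewrite ler_ln ?posrE ?log_nbar_ge //; first by rewrite ltr0n; lia.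
by have := log_nbar_ge8 j8; lra.
Qed.

Lemma nbar_ge j : (8 <= j)%N -> log_nbar j + 1 <= nbar R j.
Proof. by move=> j8; rewrite nbarE ?(leq_trans _ j8) // addrC expR_ge1Dx. Qed.

Lemma normingE j : (0 < j)%N -> norming j = nbar R j * ln (log_nbar j) / ln 2.
Proof. by move=> j0; rewrite /norming ln_nbar. Qed.

Lemma norming_ge j : (8 <= j)%N -> nbar R j * ln (log_nbar j) <= norming j.
Proof.
move=> j8; rewrite normingE ?(leq_trans _ j8) //.
have h1 := nbar_ge j8; have h2 := log_nbar_ge8 j8.
have h3 := ln_nat_ge j8; have h4 := ln_log_nbar_ge j8.
rewrite ler_pdivlMr ?ln2_gt0 // ler_piMr ?ln2_le1 //.
by rewrite mulr_ge0 //; lra.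
Qed.

Lemma norming_ge_nbar j : (8 <= j)%N -> 3 / 2 * nbar R j <= norming j.
Proof.
move=> j8; apply: le_trans (norming_ge j8).
have h1 := nbar_ge j8; have h2 := log_nbar_ge8 j8.
have h3 := ln_nat_ge j8; have h4 := ln_log_nbar_ge j8.
by rewrite mulrC ler_wpM2l //; lra.
Qed.

Lemma norming_gt0 j : (8 <= j)%N -> 0 < norming j.
Proof.
by move=> j8; have := norming_ge_nbar j8; have := nbar_ge j8; have := log_nbar_ge8 j8; lra.
Qed.

(** Crude, but after two logarithms the square costs only an additive ln 2; see
    [lnln_cutoff_near]. *)
Lemma norming_le_sqr j : (8 <= j)%N -> norming j <= nbar R j ^+ 2.
Proof.
move=> j8; rewrite normingE ?(leq_trans _ j8) //.
have h1 := nbar_ge j8; have h2 := log_nbar_ge8 j8.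
have h5 : ln (log_nbar j) <= log_nbar j by apply: ltW; apply: ln_sublinear; lra.
rewrite ler_pdivrMr ?ln2_gt0 // expr2 -mulrA ler_wpM2l //; first lra.
apply: (le_trans h5); apply: (@le_trans _ _ (nbar R j * (1 / 2))); last first.
  by rewrite ler_wpM2l ?ln2_ge //; lra.
have : (1 + log_nbar j / 2) ^+ 2 <= nbar R j.
  rewrite nbarE ?(leq_trans _ j8) // {2}(_ : log_nbar j = log_nbar j / 2 + log_nbar j / 2);
    last by lra.
  by rewrite expRD -expr2; apply: lerXn2r; rewrite ?nnegrE ?expR_ge0 ?expR_ge1Dx //; lra.
nra.
Qed.

Lemma block_end_itv j : (block_end j)%:R <= nbar R j < (block_end j)%:R + 1.
Proof.
have n0 : 0 <= nbar R j by rewrite /nbar; case: ifP => // _; exact: expR_ge0.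
by have := truncn_itv n0; rewrite natr1.
Qed.

Lemma cutoff_itv j : (8 <= j)%N -> (cutoff j)%:R <= norming j < (cutoff j)%:R + 1.
Proof. by move=> j8; have := truncn_itv (ltW (norming_gt0 j8)); rewrite natr1. Qed.

Lemma nbar_le_cutoff j : (8 <= j)%N -> nbar R j <= (cutoff j)%:R.
Proof.
move=> j8; have /andP[_ h] := cutoff_itv j8; have := norming_ge_nbar j8.
by have := nbar_ge j8; have := log_nbar_ge8 j8; lra.
Qed.

Lemma cutoff_ge2 j : (8 <= j)%N -> (2 <= cutoff j)%N.
Proof.
move=> j8; rewrite -(ler_nat R); have := nbar_le_cutoff j8.
by have := nbar_ge j8; have := log_nbar_ge8 j8; lra.
Qed.

Lemma ln_cutoff_ge j : (8 <= j)%N -> log_nbar j <= ln (cutoff j)%:R.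
Proof.
move=> j8; rewrite -ln_nbar ?(leq_trans _ j8) // ler_ln ?posrE ?nbar_le_cutoff //.
  by rewrite nbarE ?(leq_trans _ j8) // expR_gt0.
by rewrite ltr0n; have := cutoff_ge2 j8; lia.
Qed.

Lemma ln_cutoff_le j : (8 <= j)%N -> ln (cutoff j)%:R <= 2 * log_nbar j.
Proof.
move=> j8; have n0 : 0 < nbar R j by rewrite nbarE ?(leq_trans _ j8) // expR_gt0.
rewrite -ln_nbar ?(leq_trans _ j8) // mulr_natl -lnXn //.
rewrite ler_ln ?posrE ?exprn_gt0 //; last by rewrite ltr0n; have := cutoff_ge2 j8; lia.
by have /andP[h _] := cutoff_itv j8; rewrite (le_trans h) // norming_le_sqr.
Qed.

Lemma lnln_cutoff_near j : (8 <= j)%N -> `|ln (ln (cutoff j)%:R) - ln (log_nbar j)| <= 1.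
Proof.
move=> j8; have h1 := ln_cutoff_ge j8; have h2 := ln_cutoff_le j8; have h3 := log_nbar_ge8 j8.
have L0 : 0 < log_nbar j by lra.
have k1 : ln (log_nbar j) <= ln (ln (cutoff j)%:R) by rewrite ler_ln ?posrE //; lra.
have k2 : ln (ln (cutoff j)%:R) <= ln 2 + ln (log_nbar j).
  by rewrite -lnM ?posrE // ler_ln ?posrE //; lra.
by have := ln2_le1 R; rewrite ler_norml; lra.
Qed.

(** 1/(j (ln j)^2) is at most 1/ln(j-1) - 1/ln j, which telescopes. The squared logarithm in the
    exponent of [nbar] is what makes the Borel-Cantelli series converge. *)
Lemma sum_inv_log_nbar_le N : \sum_(0 <= j < N) (log_nbar (j + 8))^-1 <= 2.
Proof.
apply: (@le_trans _ _ ((ln 7)^-1 - (ln (N + 7)%:R)^-1)); last first.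
  have : 1 / 2 <= ln 7 :> R by apply: le_trans (ln2_ge R) _; rewrite ler_ln ?posrE // ler_nat.
  move=> h; have : (ln 7)^-1 <= 2 :> R by rewrite -[2%:R in leRHS]invrK lef_pV2 ?posrE
    ?invr_gt0 //; lra.
  have : 0 <= (ln (N + 7)%:R)^-1 :> R by rewrite invr_ge0 ln_nat_ge0.
  lra.
elim: N => [|N IH]; first by rewrite big_geq // add0n subrr.
rewrite big_nat_recr //= (le_trans (lerD IH (lexx _))) //.
rewrite addSn -addnS /log_nbar.
have a0 : 0 < ln (N + 7)%:R :> R by rewrite ln_gt0 // ltr1n; lia.
have b0 : 0 < ln (N + 8)%:R :> R by rewrite ln_gt0 // ltr1n; lia.
have x0 : 0 < (N + 8)%:R :> R by rewrite ltr0n; lia.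
have y0 : 0 < (N + 7)%:R :> R by rewrite ltr0n; lia.
have ab : ln (N + 7)%:R <= ln (N + 8)%:R :> R by rewrite ler_ln ?posrE // ler_nat; lia.
have := ln_sub_ge y0 x0; rewrite -natrB; last lia.
rewrite (_ : (N + 8 - (N + 7))%N = 1%N); last lia.
move: ((N + 8)%:R : R) (ln (N + 7)%:R : R) (ln (N + 8)%:R : R) a0 b0 x0 ab => z a b a0 b0 z0 ab
  h.
have : (z * b ^+ 2)^-1 <= (b - a) / (a * b).
  apply: (@le_trans _ _ (z^-1 / (a * b))); last first.
    apply: ler_wpM2r; first by apply: ltW; rewrite invr_gt0; apply: mulr_gt0.
    by move: h; rewrite mulr1n mul1r.
  rewrite invfM ler_wpM2l ?invr_ge0 ?(ltW z0) // lef_pV2 ?posrE ?mulr_gt0 ?exprn_gt0 //.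
  by rewrite expr2 ler_wpM2r // ltW.
have -> : (b - a) / (a * b) = a^-1 - b^-1 by field; rewrite !gt_eqF.
lra.
Qed.

Lemma log_nbar_large (A : R) : exists J, forall j, (J <= j)%N -> (8 <= j)%N /\ A <= ln
  (log_nbar j).
Proof.
exists (maxn 8 (Num.truncn (expR A)).+1) => j; rewrite geq_max => /andP[j8 jA]; split => //.
have j0 : 0 < j%:R :> R by rewrite ltr0n; lia.
have /andP[_ h] := truncn_itv (expR_ge0 A).
apply: le_trans (ln_log_nbar_ge j8); rewrite -[A]expRK ler_ln ?posrE ?expR_gt0 //.
by rewrite (le_trans (ltW h)) // ler_nat.
Qed.

(** Bookkeeping in multiples of eD: the centered part costs 1, the 8 per digit costs 1, the error in
    the sum of 1+s costs 6, and replacing N m by nb l costs 3, for a total of 11. *)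
Lemma ratio_bound (S m N nb D l l2 e C P B : R) :
  0 < l2 <= 1 -> D = nb * l / l2 -> nb - 1 <= N <= nb -> 0 <= N -> 0 <= m -> `|m - l| <= C ->
  0 < e <= 1 -> 8 <= e * l -> C <= e * l -> B <= e * nb -> l <= nb -> P <= e ->
  `|S - N / l2 * m| <= e * D + 8 * N + m * (e * N + B + N * P) ->
  `|S - D| <= 11 * e * D.
Proof.
move=> /andP[l20 l21] DE /andP[N1 N2] N0 m0 ml /andP[e0 e1] el Ce Be lnb Pe h.
have l0 : 0 < l by nra.
have nb0 : 0 < nb by lra.
have D1 : nb * l <= D by rewrite DE ler_pdivlMr // ler_piMr // mulr_ge0 ?ltW.
have m2 : m <= 2 * l by move: ml; rewrite ler_norml; nra.
have d1 : `|N / l2 * m - D| <= 3 * e * D.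
  rewrite (_ : N / l2 * m - D = (N * m - nb * l) / l2); last by rewrite DE; field;
    rewrite gt_eqF.
  rewrite normrM normfV [`|l2|]gtr0_norm // DE [leRHS]mulrA ler_pM2r ?invr_gt0 //.
  have a1 : (nb - N) * m <= 1 * (2 * l) by apply: ler_pM => //; lra.
  have a2 : nb * `|m - l| <= nb * (e * l) by rewrite ler_wpM2l ?(ltW nb0) // (le_trans ml).
  have a3 : 1 <= e * nb by nra.
  have a4 : 1 * l <= e * nb * l by rewrite ler_wpM2r // ltW.
  have a5 : N * m - nb * l = nb * (m - l) - (nb - N) * m by ring.
  have a6 : 0 <= (nb - N) * m by rewrite mulr_ge0 //; lra.
  rewrite a5; apply: (le_trans (ler_normB _ _)); rewrite normrM (gtr0_norm nb0) (ger0_norm a6);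
    lra.
have d2 : 8 * N <= e * D.
  have : 8 * N <= e * l * nb by apply: ler_pM.
  have : e * (nb * l) <= e * D by rewrite ler_wpM2l // ltW.
  lra.
have d3 : m * (e * N + B + N * P) <= 6 * e * D.
  have b1 : e * N <= e * nb by rewrite ler_wpM2l // ltW.
  have b2 : N * P <= nb * e.
    by apply: (@le_trans _ _ (N * e)); [rewrite ler_wpM2l|rewrite ler_wpM2r // ltW].
  apply: (@le_trans _ _ (m * (3 * (e * nb)))); first by rewrite ler_wpM2l //; lra.
  apply: (@le_trans _ _ (2 * l * (3 * (e * nb)))).
    by rewrite ler_wpM2r // !mulr_ge0 // ltW.
  have : e * (nb * l) <= e * D by rewrite ler_wpM2l // ltW.
  lra.
rewrite (_ : S - D = (S - N / l2 * m) + (N / l2 * m - D)); last by ring.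
by apply: (le_trans (ler_normD _ _)); lra.
Qed.

Definition prime_word_sum (w : seq nat) : R := word_sum (fun _ k => if prime k.+1 then k.+1%:R
  else 0) w.

Lemma block_end_ge j : (8 <= j)%N -> log_nbar j <= (block_end j)%:R.
Proof. by move=> j8; have /andP[_] := block_end_itv j; have := nbar_ge j8; lra. Qed.

(** Each of at most K digits is a prime above K with probability at most 8/(K ln K). The shift by 8
    keeps to indices where the size estimates hold. *)
Lemma large_prime_ae :
  {ae @lebesgue_measure R, forall x, infinite_cf x -> exists J, forall j, (J <= j)%N ->
    ~~ has (large_prime (cutoff (j + 8))) (cf_word (block_end (j + 8)) x)}.
Proof.
apply: (@cf_borel_cantelli R (fun j => has (large_prime (cutoff (j + 8)))) (fun j => block_end
  (j + 8)) (fun j => 8 * (log_nbar (j + 8))^-1)).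
  move=> j; have j8 : (8 <= j + 8)%N by lia.
  apply: le_trans (has_digit_tail (tau := 8 / ((cutoff (j + 8))%:R * ln (cutoff (j + 8))%:R)) _
    _) _.
    by move=> s N s01; apply: large_prime_psum_le => //; exact: cutoff_ge2.
  rewrite lee_fin; have /andP[h1 _] := block_end_itv (j + 8).
  have h2 := nbar_le_cutoff j8; have h3 := ln_cutoff_ge j8; have h4 := log_nbar_ge8 j8;
    have h5 := nbar_ge j8.
  move: h1 h2 h3 h4 h5.
  move: ((block_end (j + 8))%:R : R) (ler0n R (block_end (j + 8))) (nbar R (j + 8)) => N N0 nb.
  move: ((cutoff (j + 8))%:R : R) (ln (cutoff (j + 8))%:R : R) (log_nbar (j + 8)) => K k L h1
    h2 h3 h4 h5.
  have K0 : 0 < K by lra. have k0 : 0 < k by lra.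
  have L0 : 0 < L by lra.
  have Kk : N * L <= K * k by apply: ler_pM; lra.
  rewrite -subr_ge0 (_ : _ - _ = 8 * (K * k - N * L) / (L * (K * k))); last by field;
    rewrite !gt_eqF.
  by rewrite divr_ge0 ?mulr_ge0 ?(ltW L0) ?(ltW K0) ?(ltW k0) // subr_ge0.
exists (8 * 2) => N; rewrite -mulr_sumr ler_pM2l //; exact: sum_inv_log_nbar_le.
Qed.

(** With N digits, D the norming and L = ln [nbar], the bound is 2 N pi(K)/(eD)^2; since N <= D and
    pi(K) L <= 6K <= 6D, it is at most 12/(e^2 L). *)
Lemma trunc_prime_ae e : 0 < e ->
  {ae @lebesgue_measure R, forall x, infinite_cf x -> exists J, forall j, (J <= j)%N ->
    ~~ (e * norming (j + 8) < `|word_sum (centered (fun=> @trunc_prime R (cutoff (j + 8))))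
      (cf_word (block_end (j + 8)) x)|)}.
Proof.
move=> e0.
apply: (@cf_borel_cantelli R (fun j w => e * norming (j + 8) < `|word_sum (centered (fun=>
  trunc_prime R (cutoff (j + 8)))) w|) (fun j => block_end (j + 8)) (fun j => 12 / e ^+ 2 *
  (log_nbar (j + 8))^-1)).
  move=> j; have j8 : (8 <= j + 8)%N by lia.
  have D0 := norming_gt0 j8.
  have S0 : 0 <= prime_sum (fun=> 1) (cutoff (j + 8)) :> R by exact: sumr_ge0.
  apply: le_trans (word_sum_centered_tail (sigma := 2 * prime_sum (fun=> 1) (cutoff (j + 8))) _
    _ _ _ _) _.
  - by rewrite mulr_gt0.
  - by rewrite mulr_ge0.
  - by move=> s _; exact: trunc_prime_bounded.
  - by move=> s s01; exact: trunc_prime_sqr_le.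
  rewrite lee_fin; have /andP[h1 _] := block_end_itv (j + 8); have /andP[g _] := cutoff_itv j8.
  have h2 := prime_count_le R (cutoff (j + 8)).
  have h3 := ln_cutoff_ge j8; have h4 := log_nbar_ge8 j8; have h5 := norming_ge_nbar j8;
    have h6 := nbar_ge j8.
  move: h1 g h2 h3 h4 h5 h6 D0 S0.
  move: (prime_sum _ _ : R).
  move: ((block_end (j + 8))%:R : R) (ler0n R (block_end (j + 8))) (nbar R (j + 8)) => N N0 nb.
  move: ((cutoff (j + 8))%:R : R) (ln (cutoff (j + 8))%:R : R) (log_nbar (j + 8)) (norming (j +
    8)).
  move=> K k L D p h1 g h2 h3 h4 h5 h6 D0 S0.
  have L0 : 0 < L by lra.
  rewrite exprMn ler_pdivrMr ?mulr_gt0 ?exprn_gt0 //.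
  rewrite (_ : 12 / e ^+ 2 / L * _ = 12 * D ^+ 2 / L); last by field; rewrite !gt_eqF.
  rewrite ler_pdivlMr //.
  have pL : p * L <= p * k by rewrite ler_wpM2l.
  have : N * (2 * (p * L)) <= D * (12 * D).
    by apply: ler_pM => //; rewrite ?mulr_ge0 ?(ltW L0) //; lra.
  rewrite expr2; lra.
exists (12 / e ^+ 2 * 2) => N; rewrite -mulr_sumr ler_wpM2l ?divr_ge0 ?exprn_ge0 ?(ltW e0) //;
  exact: sum_inv_log_nbar_le.
Qed.

(** The summands are bounded by 4M before centering, so Chebyshev gives a multiple of 1/N, and N is
    at least ln [nbar]. *)
Lemma potential_ae M e : 0 < e ->
  {ae @lebesgue_measure R, forall x, infinite_cf x -> exists J, forall j, (J <= j)%N ->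
    ~~ (e * (block_end (j + 8))%:R < `|word_sum (centered (fun s k => potential M (next_state s
      k))) (cf_word (block_end (j + 8)) x)| :> R)}.
Proof.
move=> e0.
apply: (@cf_borel_cantelli R (fun j w => e * (block_end (j + 8))%:R < `|word_sum (centered (fun
  s k => potential M (next_state s k))) w|) (fun j => block_end (j + 8)) (fun j => (4 * M%:R)
  ^+ 2 / e ^+ 2 * (log_nbar (j + 8))^-1)).
  move=> j; have j8 : (8 <= j + 8)%N by lia.
  have h4 := log_nbar_ge8 j8; have h5 := block_end_ge j8.
  have b s : 0 <= s <= 1 -> bounded_seq (fun k => potential M (next_state s k)).
    by move=> s01; exists (4 * M%:R) => k; apply: potential_norm; exact: next_state01.
  apply: le_trans (word_sum_centered_tail (sigma := (4 * M%:R) ^+ 2) _ _ _ _ _) _.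
  - by rewrite mulr_gt0 //; lra.
  - by rewrite sqr_ge0.
  - exact: b.
  - move=> s s01; have /andP[s0 s1] := s01; rewrite -[leRHS](digit_mean_cst _ s01).
    apply: digit_mean_le => //; [by apply: bounded_seqM; exact: b|exact: bounded_seq_cst|].
    move=> k; have := potential_norm M (next_state01 k s01).
    by move=> h; rewrite -real_normK ?num_real // !expr2 ler_pM.
  rewrite lee_fin; move: h4 h5.
  move: ((block_end (j + 8))%:R : R) (log_nbar (j + 8)) ((4 * M%:R) ^+ 2 : R) (sqr_ge0 (4 *
    M%:R : R)) => N L q q0 h4 h5.
  have N0 : 0 < N by lra.
  rewrite (_ : N * q / (e * N) ^+ 2 = q / e ^+ 2 / N); last by field; rewrite !gt_eqF.
  by rewrite ler_wpM2l ?divr_ge0 ?exprn_ge0 ?(ltW e0) // lef_pV2 ?posrE //; lra.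
exists ((4 * M%:R) ^+ 2 / e ^+ 2 * 2) => N;
  rewrite -mulr_sumr ler_wpM2l ?divr_ge0 ?exprn_ge0 ?(ltW e0) //; exact: sum_inv_log_nbar_le.
Qed.

Lemma prime_word_sum_ae e : 0 < e <= 1 ->
  {ae @lebesgue_measure R, forall x, infinite_cf x -> exists J, forall j, (J <= j)%N ->
    `|prime_word_sum (cf_word (block_end j) x) - norming j| <= 11 * e * norming j}.
Proof.
move=> e01; have /andP[e0 e1] := e01.
have [M hM] : exists M, 2 * (7 / 8) ^+ M <= e :> R.
  have : (fun M => 2 * (7 / 8) ^+ M) @ \oo --> (2 * 0 : R).
    by apply: cvgMr; apply: cvg_expr; rewrite ger0_norm; lra.
  rewrite mulr0 => /cvgrPdist_le/(_ e e0)[M _ /(_ M (leqnn M))] /=.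
  rewrite sub0r normrN => h; exists M; exact: le_trans (ler_norm _) h.
have [C hC] := mertens2 R.
apply: (@filterS3 _ _ (ae_filter_ringOfSetsType _) _ _ _ _ _ (potential_ae M e0)
  (trunc_prime_ae e0) large_prime_ae) => x hp ht hl xI.
have [J1 H1] := hp xI; have [J2 H2] := ht xI; have [J3 H3] := hl xI.
(* The three thresholds are the largeness hypotheses of [ratio_bound]; in C + 1, C comes from
   [mertens2] and 1 from [lnln_cutoff_near]. *)
have [J4 H4] := log_nbar_large (Num.max (8 / e) (Num.max ((C + 1) / e) (8 * M%:R / e))).
exists (maxn J4 (maxn (J1 + 8) (maxn (J2 + 8) (J3 + 8)))) => j.
rewrite !geq_max => /andP[j4 /andP[j1 /andP[j2 j3]]].
have [j8] := H4 j j4; rewrite !ge_max !ler_pdivrMr // => /and3P[e8 eC eM].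
have jE : j = (j - 8 + 8)%N by lia.
have := H1 (j - 8)%N ltac:(lia); have := H2 (j - 8)%N ltac:(lia);
  have := H3 (j - 8)%N ltac:(lia).
rewrite -jE -!leNgt => small k2 k1.
have := word_sum_prime_near R M small; rewrite size_cf_word => near.
have K2 := cutoff_ge2 j8; have := hC _ K2; have := lnln_cutoff_near j8.
set m := prime_sum _ _ in near * => c1 c2.
have m0 : 0 <= m by apply: sumr_ge0 => p _; rewrite invr_ge0.
have /andP[b1 b2] := block_end_itv j.
have ln1 : ln (log_nbar j) <= nbar R j.
  have := nbar_ge j8; have := log_nbar_ge8 j8; move=> q1 q2.
  have : ln (log_nbar j) <= log_nbar j by apply: ltW; apply: ln_sublinear; lra.
  lra.
apply: (@ratio_bound _ m (block_end j)%:R (nbar R j) _ (ln (log_nbar j)) (ln 2) e (C + 1) (2 *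
  (7 / 8) ^+ M) (8 * M%:R)) => //.
- by rewrite ln2_gt0 ln2_le1.
- by rewrite normingE // (leq_trans _ j8).
- by apply/andP; split; lra.
- by rewrite (_ : m - _ = (m - ln (ln (cutoff j)%:R)) + (ln (ln (cutoff j)%:R) - ln (log_nbar
  j))); [rewrite (le_trans (ler_normD _ _)) // lerD|ring].
- by rewrite mulrC.
- by rewrite mulrC.
- by apply: (@le_trans _ _ (e * ln (log_nbar j)));
  [rewrite [leRHS]mulrC|rewrite ler_wpM2l // ltW].
apply: (le_trans near); rewrite lerD ?ler_wpM2l //; first by rewrite lerD.
by rewrite !lerD.
Qed.

End Blocks.

(** * From the ends of the blocks to the limsup over all n *)

Section Limsup.
Variable R : realType.
Implicit Types (i j n : nat) (x e : R).

Definition prime_digit_sum n x : R := \sum_(1 <= k < n.+1) (prime_digit k x)%:R.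

Lemma prime_word_sumE n x : infinite_cf x -> prime_word_sum R (cf_word n x) = prime_digit_sum n
  x.
Proof.
move=> xI; elim: n => [|n IH]; first by rewrite /prime_digit_sum big_geq.
rewrite /prime_digit_sum big_nat_recr //= -/(prime_digit_sum n x) -IH.
rewrite /prime_word_sum /=; congr (_ + _).
by rewrite /prime_digit prednK ?cf_digit_gt0 //; case: ifP.
Qed.

Lemma prime_digit_sum_le x m n : (m <= n)%N -> prime_digit_sum m x <= prime_digit_sum n x.
Proof.
move=> mn; rewrite /prime_digit_sum [leRHS](@big_cat_nat _ _ _ m.+1) //=.
by rewrite lerDl sumr_ge0.
Qed.

Lemma nbar_le i j : (i <= j)%N -> nbar R i <= nbar R j.
Proof.
case: i => [|i] ij; first by rewrite {1}/nbar /=; rewrite /nbar; case: ifP => // _;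
  exact: expR_ge0.
rewrite !nbarE // ?ler_expR /log_nbar; last exact: leq_trans ij.
apply: ler_pM => //; rewrite ?sqr_ge0 ?ler_nat //.
by rewrite !expr2 ler_pM ?ln_nat_ge0 // ler_ln ?posrE ?ltr0n ?ler_nat //; lia.
Qed.

Lemma nbar_step j : (8 <= j)%N -> nbar R j + 1 <= nbar R j.+1.
Proof.
move=> j8; have j0 : (0 < j)%N by lia.
have h : 1 <= log_nbar R j.+1 - log_nbar R j.
  rewrite /log_nbar; have := ln_nat_ge R j8.
  have : ln j%:R <= ln j.+1%:R :> R by rewrite ler_ln ?posrE ?ltr0n // ler_nat.
  have := ler0n R j; move: (ln j.+1%:R : R) (ln j%:R : R) => b a; rewrite -[j.+1%:R]natr1.
  move: (j%:R : R) => y y0 ab a1.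
  have : 0 <= y * (b ^+ 2 - a ^+ 2) by rewrite mulr_ge0 // subr_ge0 !expr2 ler_pM //; lra.
  have : 1 <= b ^+ 2 by rewrite expr_ge1 //; lra.
  lra.
rewrite !nbarE // -[log_nbar R j.+1](subrK (log_nbar R j)) expRD.
have e1 : 1 <= expR (log_nbar R j) by rewrite -expR0 ler_expR; have := log_nbar_ge8 R j8; lra.
have := expR_ge1Dx (log_nbar R j.+1 - log_nbar R j); nra.
Qed.

Lemma jidx_le n i : (i <= n)%N -> n%:R <= nbar R i -> (jidx R n <= i)%N.
Proof.
move=> i_n h; rewrite leqNgt; apply/negP => /(before_find 0%N).
by rewrite nth_iota ?ltnS // add0n h.
Qed.

Lemma jidxP n : (8 <= n)%N -> n%:R <= nbar R (jidx R n).
Proof.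
move=> n8; have h : has (fun j => n%:R <= nbar R j) (iota 0 n.+1).
  apply/hasP; exists n; first by rewrite mem_iota; lia.
  by have := nbar_ge R n8; have := log_nbar_ge R n8; lra.
have jn : (jidx R n < n.+1)%N by move: h; rewrite has_find size_iota.
by have := nth_find 0%N h; rewrite -/(jidx R n) nth_iota.
Qed.

(** Rounding [nbar j] down does not leave block j because [nbar] grows by at least 1 from j-1 to j;
    applying [nbar_step] at j-1 turns 8 into 9. *)
Lemma jidx_block_end j : (9 <= j)%N -> jidx R (block_end R j) = j.
Proof.
move=> j9; have j8 : (8 <= j)%N by lia.
have jb : (j <= block_end R j)%N.
  by rewrite -(ler_nat R); have := block_end_ge R j8; have := log_nbar_ge R j8; lra.
have /andP[b1 b2] := block_end_itv R j.
apply/eqP; rewrite eqn_leq jidx_le //= leqNgt; apply/negP => ij.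
have h1 : nbar R (jidx R (block_end R j)) <= nbar R j.-1 by apply: nbar_le; lia.
have h2 := jidxP (leq_trans j8 jb).
have := @nbar_step j.-1 ltac:(lia); rewrite prednK; last lia.
lra.
Qed.

Lemma dprimeE n : dprime R n = norming R (jidx R n).
Proof. by []. Qed.

Lemma jidx_large J : exists n0, forall n, (n0 <= n)%N -> (J <= jidx R n)%N.
Proof.
exists (maxn 8 (block_end R J).+1) => n; rewrite geq_max => /andP[n8 nJ].
rewrite leqNgt; apply/negP => /ltnW/nbar_le h.
have := jidxP n8; have /andP[_] := block_end_itv R J.
have : (block_end R J)%:R + 1 <= n%:R :> R by rewrite natr1 ler_nat.
lra.
Qed.

Lemma limn_esup_ratio x :
  (forall i, exists J, forall j, (J <= j)%N ->
     `|prime_digit_sum (block_end R j) x - norming R j| <= 11 * i.+1%:R^-1 * norming R j) ->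
  limn_esup (fun n => (prime_digit_sum n x / dprime R n)%:E) = 1%E.
Proof.
move=> H.
have small (e : R) : 0 < e -> exists i, 11 * i.+1%:R^-1 <= e.
  move=> e0; exists (Num.truncn (11 / e)).
  have /andP[_ h] := truncn_itv (ltW (divr_gt0 (ltr0n R 11) e0)).
  by rewrite ler_pdivrMr ?ltr0n // mulrC -ler_pdivrMr // ltW.
apply/eqP; rewrite eq_le; apply/andP; split.
  apply/lee_addgt0Pr => e e0; have [i hi] := small e e0; have [J HJ] := H i.
  have [n0 hn0] := jidx_large (maxn J 8).
  apply: (@le_trans _ _ (ereal_sup [set (prime_digit_sum n x / dprime R n)%:E | n in [set n |
    (maxn n0 8 <= n)%N]])).
    apply: ereal_inf_lbound; exists [set n | (maxn n0 8 <= n)%N] => //.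
    by exists (maxn n0 8).
  apply: ge_ereal_sup => _ [n /= + <-]; rewrite geq_max => /andP[nn0 n8].
  have := hn0 n nn0; rewrite geq_max => /andP[jJ j8].
  rewrite dprimeE -EFinD lee_fin ler_pdivrMr ?norming_gt0 //.
  (* n does not pass the end of its own block, where the sum is larger and the norming is the
     same. *)
  have : prime_digit_sum n x <= prime_digit_sum (block_end R (jidx R n)) x.
    apply: prime_digit_sum_le; rewrite -ltnS -(ltr_nat R).
    have := jidxP n8; have /andP[_] := block_end_itv R (jidx R n).
    by rewrite -natr1; exact: (fun a b => le_lt_trans b a).
  have := HJ _ jJ; rewrite ler_norml => /andP[_].
  have := ler_wpM2r (ltW (norming_gt0 R j8)) hi.
  move: (norming R _) (11 * _ * _) (prime_digit_sum n x) (prime_digit_sum _ x) => D q a b.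
  rewrite mulrDl mul1r lerBlDl => h1 h2 h3.
  by rewrite (le_trans h3) // (le_trans h2) // lerD2l.
apply/lee_subgt0Pr => e e0; have [i hi] := small e e0; have [J HJ] := H i.
apply: le_ereal_inf_tmp => _ [A [n0 _ An0] <-].
(* Every tail of the integers contains an end of a block, where the ratio is already close to 1. *)
pose j := maxn (maxn J 9) n0.
have jJ : (J <= j)%N by rewrite /j !leq_max leqnn.
have j9 : (9 <= j)%N by rewrite /j !leq_max leqnn orbT.
have jn0 : (n0 <= j)%N by rewrite /j !leq_max leqnn orbT.
have j8 : (8 <= j)%N by lia.
apply: (@le_trans _ _ (prime_digit_sum (block_end R j) x / dprime R (block_end R j))%:E);
  last first.
  apply: ereal_sup_ubound; exists (block_end R j) => //; apply: An0 => /=.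
  apply: (leq_trans jn0); rewrite -(ler_nat R).
  by have := block_end_ge R j8; have := log_nbar_ge R j8; lra.
rewrite dprimeE jidx_block_end // -EFinB lee_fin ler_pdivlMr ?norming_gt0 //.
have := HJ _ jJ; rewrite ler_norml => /andP[+ _].
have := ler_wpM2r (ltW (norming_gt0 R j8)) hi.
move: (norming R _) (11 * _ * _) (prime_digit_sum _ x) => D q a.
rewrite mulrBl mul1r; lra.
Qed.

End Limsup.

Theorem theorem2p6 (R : realType) :
  {ae (@lebesgue_measure R), forall x : R, x \in `]0, 1] ->
     limn_esup (fun n : nat =>
       ((\sum_(1 <= k < n.+1) (prime_digit k x)%:R) / dprime R n)%:E) = 1%E}.
Proof.
(* Taking e = 1/(i+1) leaves countably many null sets, so a single one serves all i. *)
have H : {ae @lebesgue_measure R, forall x (i : nat), infinite_cf x -> exists J, forall j, (J <= j)%N ->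
    `|prime_word_sum R (cf_word (block_end R j) x) - norming R j| <= 11 * i.+1%:R^-1 * norming R j}.
  apply: ae_foralln => i; apply: prime_word_sum_ae.
  by rewrite invr_gt0 ltr0n invf_le1 ?ltr0n // ler1n.
apply: (@filterS2 _ _ (ae_filter_ringOfSetsType _) _ _ _ _ H (@not_infinite_cf_negligible R)) => x h xI x01.
have {}xI := xI x01; apply: limn_esup_ratio => i; have [J HJ] := h i xI.
by exists J => j jJ; rewrite -prime_word_sumE //; exact: HJ.
Qed.
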